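(* Consider $dy_t=S(t)dt+d\xi_t$, $0\le t\le n$, with noise distribution in a family $\mathcal{Q}_n$ satisfying: $\mathcal{Q}_n\subseteq\{Q:\ \mathbf{L}_{1,n}(Q)+\mathbf{L}_{2,n}(Q)\le l_n\}$, and $$0<\varsigma_*:=\inf_{Q\in\mathcal{Q}_n}\varsigma_Q\le\sup_{Q\in\mathcal{Q}_n}\varsigma_Q=:\varsigma^*<\infty,\qquad \sigma^*:=\sup_{Q\in\mathcal{Q}_n}\sigma_Q<\infty .$$ Assume that $S$ is continuously differentiable (for $0\le t<1$) with $|\dot S|_1=\int_0^1|\dot S(t)|dt<+\infty$. Let $\widehat S_*$ be the model selection procedure with the weight set $\Gamma=\{\gamma_\alpha,\ \alpha\in\mathcal{A}_n\}$ described in the context, the estimator $\widehat\sigma_n=\sum_{j=l}^n\widehat\theta_{j,n}^2$, $l=[\sqrt n]+1$, and penalty coefficient $\rho=\rho_n\in(0,1/3)$, where $\rho_n\to0$ and $\lim_{n\to\infty}n^\delta\rho_n=+\infty$ for every $\delta>0$. Then for any $n\ge 2$ (for which the elements of $\Gamma$ meet the standing requirement $0\le\gamma(j)\le1$, $0<\#(\gamma)\le n$) $$\mathcal{R}^*_n(\widehat S_*,S)\le\frac{1+3\rho_n-2\rho_n^2}{1-3\rho_n}\min_{\gamma\in\Gamma}\mathcal{R}^*_n(\widehat S_\gamma,S)+\frac1n\mathcal{B}^*_1(n,\rho_n),$$ where, with $\nu=\mathrm{card}(\Gamma)$ and $\mu=\max_{\gamma\in\Gamma}\#(\gamma)$,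 $$\mathcal{B}^*_1(n,\rho)=\frac{2\varsigma^*\sigma^*\nu+4\varsigma^*l_n+2\nu l_n}{\varsigma_*\rho(1-3\rho)}+\frac{6\mu}{(1-3\rho)\sqrt n}\left(4|\dot S|_1^2+\varsigma^*+\sqrt{l_n}+\frac{4|\dot S|_1\sqrt{\sigma^*}}{n^{1/4}}+\frac{l_n}{n^{1/2}}\right),$$ and for any $\delta>0$ $$\lim_{n\to\infty}\frac{\mathcal{B}^*_1(n,\rho_n)}{n^\delta}=0.$$
   Context: Model: $n$ is a positive integer, $S$ is an unknown 1-periodic function in $L_2[0,1]$, and $(\xi_t)_{0\le t\le n}$ is an unobservable semimartingale with values in the Skorokhod space $\mathcal{D}[0,n]$ whose distribution $Q$ belongs to a family $\mathcal{Q}_n$ of probability measures on $\mathcal{D}[0,n]$. For every $Q\in\mathcal{Q}_n$ and $f\in L_2[0,n]$ the integral $I_n(f)=\int_0^nf_s\,d\xi_s$ is well defined with $\mathbf{E}_QI_n(f)=0$ and $\mathbf{E}_QI_n^2(f)\le\sigma_Q\int_0^nf_s^2ds$, for a constant $\sigma_Q>0$ attached to $Q$. $\mathbf{E}_{Q,S}$ is expectation under the law of $(y_t)_{0\le t\le n}$. Risks: $\mathcal{R}_Q(\widehat S,S)=\mathbf{E}_{Q,S}\|\widehat S-S\|^2$ with $\|f\|^2=\int_0^1f^2(t)dt$, and robust risk $\mathcal{R}^*_n(\widehat S,S)=\sup_{Q\in\mathcal{Q}_n}\mathcal{R}_Q(\widehat S,S)$. Basis: $\phi_1=1$ and, for $j\ge2$,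 $\phi_j(x)=\sqrt2\cos(2\pi[j/2]x)$ for even $j$, $\sqrt2\sin(2\pi[j/2]x)$ for odd $j$ ($[\cdot]$ integer part). $\xi_{j,n}=n^{-1/2}I_n(\phi_j)$. For a sequence $x=(x_j)$, $|x|^2=\sum_jx_j^2$, $\#(x)=\sum_j\mathbf{1}_{\{|x_j|>0\}}$. To each $Q$ is attached a constant $\varsigma_Q>0$ with $$\mathbf{L}_{1,n}(Q)=\sup_{x\in[-1,1]^\infty,\ \#(x)\le n}\Bigl|\sum_{j\ge1}x_j(\mathbf{E}_Q\xi_{j,n}^2-\varsigma_Q)\Bigr|<\infty,\qquad \mathbf{L}_{2,n}(Q)=\sup_{|x|\le1,\ \#(x)\le n}\mathbf{E}_Q\Bigl(\sum_{j\ge1}x_j(\xi_{j,n}^2-\mathbf{E}_Q\xi_{j,n}^2)\Bigr)^2<\infty .$$ $(l_n)$ is a fixed positive increasing sequence with $l_n\to\infty$ and $l_n/n^\delta\to0$ for every $\delta>0$. The constants $\varsigma_*,\varsigma^*,\sigma^*$ do not depend on $n$. Estimators: $\widehat\theta_{j,n}=\frac1n\int_0^n\phi_j(t)dy_t$; $\widehat S_\gamma=\sum_{j\ge1}\gamma(j)\widehat\theta_{j,n}\phi_j$; $\widetilde\theta_{j,n}=\widehat\theta_{j,n}^2-\widehat\sigma_n/n$; $\widehat P_n(\gamma)=\widehat\sigma_n|\gamma|^2/n$; $J_n(\gamma)=\sum_j\gamma^2(j)\widehat\theta_{j,n}^2-2\sum_j\gamma(j)\widetilde\theta_{j,n}+\rho\widehat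 P_n(\gamma)$. $\widehat\gamma$ is a minimizer of $J_n$ over $\Gamma$ and $\widehat S_*=\widehat S_{\widehat\gamma}$. Weights: $\mathcal{A}_n=\{1,\dots,k^*\}\times\{t_1,\dots,t_m\}$, $t_i=i\varepsilon$, $m=[1/\varepsilon^2]$, where $k^*=k^*(n)\ge1$ (integer) and $0<\varepsilon=\varepsilon(n)\le1$ satisfy $k^*(n)\to\infty$, $k^*(n)/\ln n\to0$, $\varepsilon(n)\to0$ and $n^\delta\varepsilon(n)\to+\infty$ for every $\delta>0$. For $\alpha=(\beta,t)\in\mathcal{A}_n$, $$\gamma_\alpha(j)=\mathbf{1}_{\{1\le j\le j_0\}}+\bigl(1-(j/\omega_\alpha)^\beta\bigr)\mathbf{1}_{\{j_0<j\le\omega_\alpha\}},\quad j_0=[\omega_\alpha/\ln n],\quad \omega_\alpha=(\tau_\beta\,t\,n)^{1/(2\beta+1)},\quad \tau_\beta=\frac{(\beta+1)(2\beta+1)}{\pi^{2\beta}\beta}.$$ *)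

(* Defs.v *)
From HB Require Import structures.
From mathcomp Require Import all_boot all_order all_algebra finmap.
From mathcomp Require Import all_classical all_reals all_analysis.

Set Implicit Arguments.
Unset Strict Implicit.
Unset Printing Implicit Defensive.

Import Order.TTheory GRing.Theory Num.Theory.
Import numFieldNormedType.Exports.

Local Open Scope classical_set_scope.
Local Open Scope ring_scope.

Definition cadlag (R : realType) (T : R) (x : R -> R) : Prop :=
  (forall t, 0 <= t < T -> x s @[s --> t^'+] --> x t) /\
  (forall t, 0 < t <= T -> cvg (x s @[s --> t^'-])).

(* Paths on [0, T] are represented by functions on R that vanish outside
   [0, T], so that equal paths are equal terms. *)
Record skorokhod (R : realType) (T : R) := Skorokhod {
  path :> R -> R ;
  path_cadlag : cadlag T path ;
  path_out : forall t, ~~ (0 <= t <= T) -> path t = 0 }.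

Lemma cadlag0 (R : realType) (T : R) : cadlag T (fun=> 0).
Proof.
by split=> t _; [exact: cvg_cst | apply: cvgP; exact: cvg_cst].
Qed.

Definition skorokhod0 (R : realType) (T : R) : skorokhod T :=
  @Skorokhod R T (fun=> 0) (cadlag0 T) (fun _ _ => erefl).

HB.instance Definition _ (R : realType) (T : R) :=
  gen_eqMixin (skorokhod T).
HB.instance Definition _ (R : realType) (T : R) :=
  gen_choiceMixin (skorokhod T).
HB.instance Definition _ (R : realType) (T : R) :=
  isPointed.Build (skorokhod T) (skorokhod0 T).

(* The coordinate maps generate the Borel sigma-algebra of the Skorokhod
   topology. *)
Definition cylinders (R : realType) (T : R) : set (set (skorokhod T)) :=
  [set A | exists t (B : set R), [/\ 0 <= t <= T, measurable B &
    A = [set w : skorokhod T | B (w t)]]].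

Notation D_space T := (g_sigma_algebraType (@cylinders _ T)).

Definition coord (R : realType) (T t : R) (w : D_space T) : R :=
  path (w : skorokhod T) t.

Section Semimartingale.
Context (R : realType) (T : R) (Q : probability (D_space T) R).
Implicit Types (F : R -> set (set (D_space T))) (X M A : R -> D_space T -> R).

(* Usual conditions: right-continuous and containing the null events. Indexing by all of R is
   harmless: a filtration on [0, T] extends by constants. *)
Definition filtration F : Prop :=
  [/\ forall t, sigma_algebra setT (F t),
      forall t, F t `<=` measurable,
      forall s t, s <= t -> F s `<=` F t,
      forall t, \bigcap_(u in [set u | t < u]) F u `<=` F t &
      forall t (E : set (D_space T)), measurable E -> Q E = 0%E -> F t E].

Definition adapted F X : Prop :=
  forall t, 0 <= t <= T ->
  forall B : set R, measurable B -> F t (X t @^-1` B).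

Definition martingale F M : Prop :=
  [/\ adapted F M,
      forall t, 0 <= t <= T -> Q.-integrable setT (EFin \o M t) &
      forall s t E, 0 <= s -> s <= t -> t <= T -> F s E ->
        (\int[Q]_(w in E) (M t w)%:E = \int[Q]_(w in E) (M s w)%:E)%E].

Definition stopping_time F (tau : D_space T -> R) : Prop :=
  (forall w, 0 <= tau w) /\
  (forall t, 0 <= t <= T -> F t [set w | tau w <= t]).

Definition local_martingale F M : Prop :=
  [/\ adapted F M, forall w, cadlag T (M^~ w) &
      exists tau : nat -> D_space T -> R,
        [/\ forall k, stopping_time F (tau k),
            forall k w, tau k w <= tau k.+1 w,
            {ae Q, forall w, exists k, T <= tau k w} &
            forall k, martingale F (fun t w => M (Num.min t (tau k w)) w)]].

Definition finite_variation_process F A : Prop :=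
  [/\ adapted F A, forall w, cadlag T (A^~ w) &
      forall w, bounded_variation 0 T (A^~ w)].

Definition semimartingale : Prop :=
  exists F M A, [/\ filtration F, adapted F (@coord R T),
    local_martingale F M, finite_variation_process F A &
    (forall w, M 0 w = 0 /\ A 0 w = 0) /\
    {ae Q, forall w, forall t, 0 <= t <= T -> coord t w = coord 0 w + M t w + A t w}].

End Semimartingale.

Definition L2 (R : realType) (T : R) (f : R -> R) : Prop :=
  measurable_fun `[0, T] f /\
  (\int[lebesgue_measure]_(t in `[0%R, T]) ((f t) ^+ 2)%:E < +oo)%E.

(* I f is the integral of f over ]0, T] against the coordinate process. Being
   linear on L2, equal to the increments on indicators of intervals ]s, t] and
   L2-continuous by the last clause, it is determined Q-almost surely: for
   f in L2[0, T], it is the limit in L2(Q) of the integrals of step functions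
   converging to f. *)
Definition noise_integral (R : realType) (T : R)
    (Q : probability (D_space T) R) (sigma : R)
    (I : (R -> R) -> D_space T -> R) : Prop :=
  [/\ forall f, L2 T f -> measurable_fun setT (I f),
      forall (a b : R) f g, L2 T f -> L2 T g ->
        {ae Q, forall w,
           I (fun t => a * f t + b * g t) w = a * I f w + b * I g w},
      forall s t, 0 <= s -> s <= t -> t <= T ->
        {ae Q, forall w, I \1_(`]s, t]) w = coord t w - coord s w},
      forall f, L2 T f -> ('E_Q[I f] = 0)%E &
      forall f, L2 T f ->
        ('E_Q[fun w => (I f w ^+ 2)%R] <=
         sigma%:E *
         \int[lebesgue_measure]_(t in `[0%R, T]) ((f t) ^+ 2)%:E)%E].

Definition noise_law (R : realType) (T : R) (Q : probability (D_space T) R)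
    (sigma : R) (I : (R -> R) -> D_space T -> R) : Prop :=
  [/\ semimartingale Q, 0 < sigma & noise_integral Q sigma I].

(* The basis is indexed from 1; phi 0 is never used. *)
Definition phi (R : realType) (j : nat) (x : R) : R :=
  if (j <= 1)%N then 1
  else if odd j then Num.sqrt 2 * sin (2 * pi * (j./2)%:R * x)
  else Num.sqrt 2 * cos (2 * pi * (j./2)%:R * x).

Definition pos_idx : set nat := [set j | (0 < j)%N].

(* Sequences are indexed by j >= 1. The sums over pos_idx below are finitely
   supported sums; they are only used for sequences of finite support. *)
Definition supp (R : realType) (x : nat -> R) : set nat :=
  [set j | (0 < j)%N /\ 0 < `|x j|].

Definition nb_supp (R : realType) (x : nat -> R) : nat :=
  #|` fset_set (supp x)|.

Definition sqnorm (R : realType) (x : nat -> R) : R :=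
  \sum_(j \in pos_idx) x j ^+ 2.

Section NoiseFunctionals.
Context (R : realType) (n : nat) (Q : probability (D_space (n%:R : R)) R)
  (I : (R -> R) -> D_space (n%:R : R) -> R).

Definition xi (j : nat) (w : D_space (n%:R : R)) : R :=
  I (phi j) w / Num.sqrt n%:R.

Definition Exi2 (j : nat) : R := fine 'E_Q[fun w => (xi j w ^+ 2)%R].

Definition L1n (varsigma : R) : \bar R :=
  ereal_sup [set `|\sum_(j \in pos_idx) x j * (Exi2 j - varsigma)|%:E |
    x in [set x : nat -> R |
      (forall j, -1 <= x j <= 1) /\ (supp x #<= `I_n)%card]].

Definition L2n : \bar R :=
  ereal_sup
    [set 'E_Q[fun w =>
       ((\sum_(j \in pos_idx) x j * (xi j w ^+ 2 - Exi2 j)) ^+ 2)%R]%E |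
    x in [set x : nat -> R | (supp x #<= `I_n)%card /\ Num.sqrt (sqnorm x) <= 1]].

End NoiseFunctionals.

(* An estimator is a function of the observed linear functional Y, where
   Y f stands for the integral of f over [0, n] against dy. *)
Section Estimators.
Context (R : realType) (n : nat).
Implicit Types (Y : (R -> R) -> R) (g : nat -> R).

Definition theta_hat Y (j : nat) : R := Y (phi j) / n%:R.

Definition S_hat g Y (t : R) : R :=
  \sum_(j \in pos_idx) g j * theta_hat Y j * phi j t.

Definition sigma_hat Y : R :=
  \sum_((Num.truncn (Num.sqrt (n%:R : R))).+1 <= j < n.+1) theta_hat Y j ^+ 2.

Definition theta_tilde Y (j : nat) : R :=
  theta_hat Y j ^+ 2 - sigma_hat Y / n%:R.

Definition penalty Y g : R := sigma_hat Y * sqnorm g / n%:R.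

Definition cost (rho : R) Y g : R :=
  \sum_(j \in pos_idx) g j ^+ 2 * theta_hat Y j ^+ 2
  - 2 * \sum_(j \in pos_idx) g j * theta_tilde Y j
  + rho * penalty Y g.

Definition cost_minimizer (Gam : set (nat -> R)) (rho : R)
    (ghat : ((R -> R) -> R) -> nat -> R) : Prop :=
  forall Y, Gam (ghat Y) /\ forall g, Gam g -> cost rho Y (ghat Y) <= cost rho Y g.

Definition S_select (ghat : ((R -> R) -> R) -> nat -> R) Y : R -> R :=
  S_hat (ghat Y) Y.

(* dy = S dt + dxi *)
Definition observed (S : R -> R) (I : (R -> R) -> D_space (n%:R : R) -> R)
    (w : D_space (n%:R : R)) (f : R -> R) : R :=
  \int[lebesgue_measure]_(t in `[0, n%:R]) (f t * S t) + I f w.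

Definition risk (S : R -> R) (Q : probability (D_space (n%:R : R)) R)
    (I : (R -> R) -> D_space (n%:R : R) -> R)
    (est : ((R -> R) -> R) -> R -> R) : \bar R :=
  (\int[Q]_w \int[lebesgue_measure]_(t in `[0%R, 1%R])
     ((est (observed S I w) t - S t) ^+ 2)%:E)%E.

Definition robust_risk (S : R -> R)
    (QQ : set (probability (D_space (n%:R : R)) R))
    (I : probability (D_space (n%:R : R)) R ->
         (R -> R) -> D_space (n%:R : R) -> R)
    (est : ((R -> R) -> R) -> R -> R) : \bar R :=
  ereal_sup [set risk S Q (I Q) est | Q in QQ].

End Estimators.

Section Weights.
Context (R : realType).

Definition tau_ (beta : nat) : R :=
  ((beta + 1) * (2 * beta + 1))%:R / (pi ^+ (2 * beta) * beta%:R).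

Definition omega (n beta : nat) (t : R) : R :=
  (tau_ beta * t * n%:R) `^ ((2 * beta + 1)%:R^-1).

Definition weight (n beta : nat) (t : R) (j : nat) : R :=
  let om := omega n beta t in
  let j0 := Num.truncn (om / ln n%:R) in
  (1 <= j <= j0)%:R
  + (1 - (j%:R / om) ^+ beta) * ((j0 < j)%N && (j%:R <= om))%:R.

Definition weights (n k : nat) (eps : R) : set (nat -> R) :=
  [set g | exists beta i : nat, [/\ (1 <= beta <= k)%N,
     (1 <= i <= Num.truncn (eps ^- 2))%N & g = weight n beta (i%:R * eps)]].

Definition nu (Gam : set (nat -> R)) : nat := #|` fset_set Gam|.

Definition mu (Gam : set (nat -> R)) : nat :=
  (\max_(g <- fset_set Gam) nb_supp g)%N.

End Weights.

(* dS is the derivative of S on [0, 1[ (one-sided at 0). *)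
Definition C1_signal (R : realType) (S dS : R -> R) : Prop :=
  (forall t, 0 <= t < 1 ->
     h^-1 * (S (t + h) - S t)
       @[h --> within [set h | 0 <= t + h < 1] 0^'] --> dS t) /\
  {within `[0, 1[, continuous dS}.

Definition L1norm (R : realType) (f : R -> R) : \bar R :=
  (\int[lebesgue_measure]_(t in `[0%R, 1%R[) `|f t|%:E)%E.

Definition B1 (R : realType) (vlo vhi shi dS1 : R) (n : nat) (ln_ : R)
    (nu mu : nat) (rho : R) : R :=
  (2 * vhi * shi * nu%:R + 4 * vhi * ln_ + 2 * nu%:R * ln_)
    / (vlo * rho * (1 - 3 * rho))
  + 6 * mu%:R / ((1 - 3 * rho) * Num.sqrt n%:R)
    * (4 * dS1 ^+ 2 + vhi + Num.sqrt ln_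
       + 4 * dS1 * Num.sqrt shi / n%:R `^ (4^-1)
       + ln_ / Num.sqrt n%:R).

(* Main.v *)
Require Import Defs.
From mathcomp Require Import all_boot all_order all_algebra finmap.
From mathcomp Require Import all_classical all_reals all_analysis measurable_realfun.
From mathcomp Require Import ring lra zify.
Import Order.TTheory GRing.Theory Num.Theory.
Import numFieldNormedType.Exports.
Local Open Scope classical_set_scope.
Local Open Scope ring_scope.

(** The observations enter only through theta_hat j = theta j + I (phi j) / n,
    where theta j is the j-th Fourier coefficient of the signal: the signal and
    the basis have period 1, so the integral of phi j * S over [0, n] is
    n theta j.  As the basis is orthonormal, the loss of S_hat g is a quadratic
    function of the numbers g j * theta_hat j (integral_S_hat_loss), and so is
    the cost.  Up to a term independent of g, loss minus cost is a sum of noise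
    terms, a linear one, a centred quadratic one, a bias and the error of the
    variance estimator, from which the penalty is subtracted (loss_sub_cost).

    Comparing the selected weight g with a fixed weight g0, the cost of g is at
    most that of g0, so only the noise terms of g and g0 have to be bounded.
    Young's inequality with parameter rho bounds the linear noise by a fraction
    of order rho of the two losses, part of which is absorbed on the left, and
    the quadratic noise by rho times the variances of the two estimators.  The
    penalty cancels the variance of g; that of g0 is a part of its mean loss
    (variance_le_loss).  This gives the leading constant
    (1 + 3 rho - 2 rho^2) / (1 - 3 rho).  The other side of Young's inequality
    is 1 / rho times squares of noise terms divided by their variances
    (pointwise_oracle).  For
    a fixed weight these normalized squares have bounded means: the moment
    bound on stochastic integrals handles the linear noise, the functional L2n
    the centred squares, and L1n the bias.  The selected weight is random, so
    they are summed over the class of weights, whence the factor nu in the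
    remainder (oracle_expectation).

    It remains to bound the mean error of the variance estimator
    (sigma_hat_error).  It sums theta_hat j ^ 2 over sqrt n < j <= n, so the
    signal must have little energy at these frequencies: by parts,
    |theta j| <= sqrt 2 / (pi [j / 2]) |dS|_1, hence
    sum_(j > sqrt n) theta j ^ 2 <= 4 |dS|_1 ^ 2 / sqrt n (theta_tail).

    All bounds are monotone in the constants attached to the noise law, so they
    hold uniformly over the family of laws (fixed_law_le_B1), and a minimum
    over weights is one of its terms.  Finally nu <= k / eps ^ 2 and
    mu / sqrt n <= 2 / eps, so the remainder B1 is a combination of sequences
    that grow more slowly than every power of n (B1_subpoly). *)

(** * The penalized criterion in coordinates *)

Section Pointwise.
Context (R : realType) (r : seq nat) (a x vj : nat -> R) (T s v rho mu l1 : R).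
Implicit Types g y : nat -> R.

(** Here a is the sequence of the coefficients of the signal, T its energy and
    x the noise: this is the squared distance of the signal to the estimator
    with coefficients g (a + x). *)
Definition loss g : R :=
  \sum_(j <- r) g j ^+ 2 * (a j + x j) ^+ 2
  - 2 * (\sum_(j <- r) g j * (a j + x j) * a j) + T.

Definition coord_cost g : R :=
  \sum_(j <- r) g j ^+ 2 * (a j + x j) ^+ 2
  - 2 * (\sum_(j <- r) g j * ((a j + x j) ^+ 2 - s))
  + rho * (s * (\sum_(j <- r) g j ^+ 2)).

(** This ratio and the next two are squares of noise terms divided by their
    variances, up to constants that do not depend on the weights. *)
Definition lin_ratio y : R :=
  (\sum_(j <- r) y j * a j * x j) ^+ 2 / (\sum_(j <- r) y j ^+ 2 * a j ^+ 2).
Definition quad_ratio y : R :=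
  (\sum_(j <- r) y j ^+ 2 * a j * x j) ^+ 2 / (\sum_(j <- r) y j ^+ 2 * a j ^+ 2).
Definition noise_ratio g : R :=
  (\sum_(j <- r) g j * (x j ^+ 2 - vj j)) ^+ 2 / (v * (\sum_(j <- r) g j ^+ 2)).

(** The quotient is 0 when D = 0, so m = 0 is then required
    separately. *)
Lemma young_ratio (m D : R) : 0 < rho -> 0 <= D -> (D = 0 -> m = 0) ->
  2 * m <= rho * D + m ^+ 2 / D / rho.
Proof.
move=> r0; rewrite le_eqVlt => /predU1P[<- /(_ erefl) ->|D0 _].
  by rewrite expr0n /= !mulr0 !mul0r addr0.
rewrite -subr_ge0 (_ : _ - _ = (rho * D - m) ^+ 2 / (rho * D)).
  by rewrite mulr_ge0 ?sqr_ge0// invr_ge0 mulr_ge0// ltW.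
field; lra.
Qed.

Lemma weighted_sum0 (c w : nat -> R) :
  \sum_(j <- r) c j ^+ 2 = 0 -> \sum_(j <- r) c j * w j = 0.
Proof.
move=> /eqP; rewrite psumr_eq0 => [/allP c0|j _]; last exact: sqr_ge0.
rewrite big_seq big1// => j /c0 /=; rewrite sqrf_eq0 => /eqP ->.
by rewrite mul0r.
Qed.

(** In the cost, theta_hat j ^ 2 - s stands for the unknown product
    theta_hat j * theta j of the loss; their difference is made of the linear
    noise, the centred square of the noise, the bias vj - v of its mean and the
    error v - s on the variance. *)
Lemma loss_sub_cost g :
  loss g - coord_cost g = T
    + 2 * (\sum_(j <- r) g j * a j * x j)
    + 2 * (\sum_(j <- r) g j * (x j ^+ 2 - vj j))
    + 2 * (\sum_(j <- r) g j * (vj j - v))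
    + 2 * (v - s) * (\sum_(j <- r) g j)
    - rho * s * (\sum_(j <- r) g j ^+ 2).
Proof.
have E : \sum_(j <- r) g j * ((a j + x j) ^+ 2 - s)
         - \sum_(j <- r) g j * (a j + x j) * a j
       = \sum_(j <- r) g j * a j * x j
         + \sum_(j <- r) g j * (x j ^+ 2 - vj j)
         + \sum_(j <- r) g j * (vj j - v) + (v - s) * \sum_(j <- r) g j.
  rewrite mulr_sumr -sumrB -!big_split /=.
  by apply: eq_bigr => j _; ring.
rewrite /loss /coord_cost; lra.
Qed.

(** The loss also contains the energy of the signal outside r, which is
    nonnegative by Bessel's inequality. *)
Lemma loss_ge_sum_sqr g : \sum_(j <- r) a j ^+ 2 <= T ->
  \sum_(j <- r) (g j * (a j + x j) - a j) ^+ 2 <= loss g.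
Proof.
move=> aT; rewrite [leLHS](_ : _ = \sum_(j <- r) g j ^+ 2 * (a j + x j) ^+ 2
  - 2 * (\sum_(j <- r) g j * (a j + x j) * a j) + \sum_(j <- r) a j ^+ 2).
  by rewrite lerD2l.
rewrite mulr_sumr -sumrB -big_split /=.
by apply: eq_bigr => j _; ring.
Qed.

(** Both g (a + x) and g0 (a + x) are compared with a, by
    (p - q)^2 <= 2 p^2 + 2 q^2. *)
Lemma sum_sqr_diff_le_loss g g0 : \sum_(j <- r) a j ^+ 2 <= T ->
  \sum_(j <- r) (g j - g0 j) ^+ 2 * (a j + x j) ^+ 2 <= 2 * (loss g + loss g0).
Proof.
move=> aT; have := loss_ge_sum_sqr g aT; have := loss_ge_sum_sqr g0 aT => h0 h1.
apply: le_trans (_ : _ <= 2 * (\sum_(j <- r) (g j * (a j + x j) - a j) ^+ 2 +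
   \sum_(j <- r) (g0 j * (a j + x j) - a j) ^+ 2)) _; last by lra.
rewrite -big_split mulr_sumr /= ler_sum// => j _.
rewrite -subr_ge0 [leRHS](_ : _ =
  ((g j * (a j + x j) - a j) + (g0 j * (a j + x j) - a j)) ^+ 2); last by ring.
exact: sqr_ge0.
Qed.

(** With y = g - g0, the standard deviation of the linear noise is
    proportional to the square root of D = sum y^2 a^2, so Young's inequality
    bounds this noise by rho D and lin_ratio / rho.  As a is unknown, D is compared with its
    observable version sum y^2 (a + x)^2, which the two losses control; the
    defect is at most twice a linear noise with weights y^2, to which Young's
    inequality applies again. *)
Lemma linear_term g g0 : 0 < rho < 1 -> \sum_(j <- r) a j ^+ 2 <= T ->
  (1 - rho) * (2 * (\sum_(j <- r) (g j - g0 j) * a j * x j)) <=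
  2 * rho * (loss g + loss g0) + (lin_ratio (fun j => g j - g0 j)
                                  + quad_ratio (fun j => g j - g0 j)) / rho.
Proof.
move=> /andP[r0 r1] aT; pose y j := g j - g0 j.
have := sum_sqr_diff_le_loss g g0 aT.
rewrite /lin_ratio /quad_ratio -/y.
set H := \sum_(j <- r) _; set D := \sum_(j <- r) y j ^+ 2 * a j ^+ 2.
set M := \sum_(j <- r) y j * a j * x j.
set M1 := \sum_(j <- r) y j ^+ 2 * a j * x j => H2.
have D0 : 0 <= D by apply: sumr_ge0 => j _; rewrite mulr_ge0 ?sqr_ge0.
have DE : D = \sum_(j <- r) (y j * a j) ^+ 2.
  by apply: eq_bigr => j _; rewrite exprMn.
have DH : D + 2 * M1 <= H.
  rewrite mulr_sumr -big_split /= ler_sum// => j _.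
  rewrite -subr_ge0 [leRHS](_ : _ = (y j * x j) ^+ 2) ?sqr_ge0//.
  by rewrite -/(y j); ring.
have hM : 2 * M <= rho * D + M ^+ 2 / D / rho.
  by apply: young_ratio => //; rewrite DE; exact: weighted_sum0.
have hM1 : 2 * - M1 <= rho * D + (- M1) ^+ 2 / D / rho.
  apply: young_ratio => //; rewrite DE => /weighted_sum0.
  move=> /(_ (fun j => y j * x j)) h; apply/eqP; rewrite oppr_eq0; apply/eqP.
  by rewrite -[RHS]h; apply: eq_bigr => j _; ring.
move: hM1; rewrite sqrrN => hM1.
have Z0 : 0 <= M ^+ 2 / D / rho.
  by rewrite !divr_ge0 ?sqr_ge0 ?(ltW r0).
have Z10 : 0 <= M1 ^+ 2 / D / rho.
  by rewrite !divr_ge0 ?sqr_ge0 ?(ltW r0).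
rewrite (mulrDl _ _ rho^-1); move: Z0 Z10 hM hM1.
set Z := M ^+ 2 / D / rho; set Z1 := M1 ^+ 2 / D / rho => Z0 Z10 hM hM1.
have : (1 - rho) * (2 * M) <= (1 - rho) * (rho * D + Z).
  by rewrite ler_wpM2l// subr_ge0 ltW.
have hD : (1 - rho) * D <= 2 * (loss g + loss g0) + Z1 by lra.
have : rho * ((1 - rho) * D) <= rho * (2 * (loss g + loss g0) + Z1).
  by rewrite ler_pM2l.
have : 0 <= rho * Z by rewrite mulr_ge0// ltW.
have : 0 <= (1 - rho) * Z1 by rewrite mulr_ge0// subr_ge0 ltW.
by lra.
Qed.

(** The inequality holds for every value of x, so that the weight g may be
    selected from the data; probability enters later, through the means of the
    three ratios and of |s - v|. *)
Lemma pointwise_oracle g g0 : 0 < rho < 3^-1 -> 0 < v ->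
  \sum_(j <- r) a j ^+ 2 <= T ->
  (forall f, f = g \/ f = g0 -> [/\ 0 <= \sum_(j <- r) f j <= mu,
     0 < \sum_(j <- r) f j ^+ 2 <= mu &
     `|\sum_(j <- r) f j * (vj j - v)| <= l1]) ->
  coord_cost g <= coord_cost g0 ->
  (1 - 3 * rho) * loss g <= (1 + rho) * loss g0
    + (lin_ratio (fun j => g j - g0 j) + quad_ratio (fun j => g j - g0 j)
       + noise_ratio g + noise_ratio g0) / rho
    + 2 * rho * (1 - rho) * (v * (\sum_(j <- r) g0 j ^+ 2))
    + 4 * l1 + 2 * mu * `|s - v|.
Proof.
move=> rho3 v0 aT Hf cg; have r0 : 0 < rho by case/andP: rho3.
have r1 : rho < 1 by lra.
have := @linear_term g g0 _ aT; rewrite r0 r1 => /(_ isT) /=.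
set yr := fun j => g j - g0 j.
rewrite (_ : \sum_(j <- r) (g j - g0 j) * a j * x j =
  \sum_(j <- r) g j * a j * x j - \sum_(j <- r) g0 j * a j * x j); last first.
  by rewrite -sumrB; apply: eq_bigr => j _; rewrite !mulrBl.
(* The centred noise is bounded from above for g and from below for g0, whence
   the sign e. *)
have chi f e : e = 1 \/ e = -1 -> 0 < \sum_(j <- r) f j ^+ 2 ->
    2 * (e * \sum_(j <- r) f j * (x j ^+ 2 - vj j)) <=
    rho * (v * (\sum_(j <- r) f j ^+ 2)) + noise_ratio f / rho.
  move=> e1 f0; have vf0 : 0 < v * \sum_(j <- r) f j ^+ 2 by rewrite mulr_gt0.
  have e2 : e ^+ 2 = 1 by case: e1 => ->; rewrite ?sqrrN expr1n.
  have -> : noise_ratio f = (e * \sum_(j <- r) f j * (x j ^+ 2 - vj j)) ^+ 2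
      / (v * \sum_(j <- r) f j ^+ 2) by rewrite exprMn e2 mul1r.
  apply: young_ratio; [by []|exact: ltW|].
  by move=> vf; move: vf0; rewrite vf ltxx.
have [/andP[L0 L1] /andP[q0 q1] B] := Hf g (or_introl erefl).
have [/andP[L00 L01] /andP[q00 q01] B0] := Hf g0 (or_intror erefl).
have c1 := chi g 1 (or_introl erefl) q0.
have c0 := chi g0 (-1) (or_intror erefl) q00.
have c2 : 0 <= noise_ratio g / rho.
  by rewrite !divr_ge0 ?sqr_ge0 ?(ltW r0)// mulr_ge0// ltW.
have c3 : 0 <= noise_ratio g0 / rho.
  by rewrite !divr_ge0 ?sqr_ge0 ?(ltW r0)// mulr_ge0// ltW.
have := loss_sub_cost g; have := loss_sub_cost g0.
move: B B0; rewrite !ler_norml => /andP[B1 B2] /andP[B3 B4].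
move: L0 L1 q0 q1 L00 L01 q00 q01 B1 B2 B3 B4 c1 c0 c2 c3 cg.
set L := \sum_(j <- r) g j; set q := \sum_(j <- r) g j ^+ 2.
set L' := \sum_(j <- r) g0 j; set q' := \sum_(j <- r) g0 j ^+ 2.
set M := \sum_(j <- r) g j * a j * x j; set M' := \sum_(j <- r) g0 j * a j * x j.
set b := \sum_(j <- r) g j * (vj j - v); set b' := \sum_(j <- r) g0 j * (vj j - v).
set c := \sum_(j <- r) g j * _; set c' := \sum_(j <- r) g0 j * _.
rewrite !(mulrDl _ _ rho^-1).
set W := noise_ratio g / rho; set W' := noise_ratio g0 / rho.
set Z := lin_ratio yr / rho; set Z1 := quad_ratio yr / rho.
move=> L0 Lm q0 qm L00 L0m q00 q0m B1 B2 B3 B4 c1 c0 W0 W0' cg E0 E1 lin.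
pose dl := `|s - v|.
have d0 : 0 <= dl by exact: normr_ge0.
have d1 : s - v <= dl by exact: ler_norm.
have d2 : v - s <= dl by rewrite /dl distrC ler_norm.
have p1 : (v - s) * (L - L') <= dl * mu.
  apply: le_trans (ler_norm _) _; rewrite normrM /dl distrC ler_wpM2l//.
  rewrite ler_norml; apply/andP; split; lra.
have p2 : (v - s) * q <= dl * mu.
  by apply: le_trans (_ : dl * q <= _); [rewrite ler_pM2r|rewrite ler_wpM2l].
have p3 : (s - v) * q' <= dl * mu.
  by apply: le_trans (_ : dl * q' <= _); [rewrite ler_pM2r|rewrite ler_wpM2l].
have p4 : rho * ((v - s) * q + (s - v) * q') <= rho * (2 * (dl * mu)).
  by rewrite ler_pM2l//; lra.
have dm : 0 <= dl * mu by rewrite mulr_ge0//; lra.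
have loss_diff : loss g - loss g0 <= 2 * (M - M') + W + W' + 2 * rho * (v * q')
    + 4 * l1 + (2 + 2 * rho) * (dl * mu) by lra.
have : (1 - rho) * (loss g - loss g0) <= (1 - rho) * (2 * (M - M') + W + W' +
  2 * rho * (v * q') + 4 * l1 + (2 + 2 * rho) * (dl * mu)).
  by rewrite ler_wpM2l// subr_ge0 ltW.
have : 0 <= rho * (W + W') by rewrite mulr_ge0 ?addr_ge0// ltW.
have : 0 <= rho * l1 by apply: mulr_ge0; lra.
have : 0 <= rho * rho * (dl * mu) by apply: mulr_ge0 => //; apply: mulr_ge0; exact: ltW.
rewrite -/dl; lra.
Qed.

End Pointwise.

(** * The trigonometric basis *)

Section Trig.
Context {R : realType}.
Notation leb := (@lebesgue_measure R).

Lemma sin_le_id (x : R) : 0 <= x -> `|sin x| <= x.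
Proof.
rewrite le_eqVlt => /predU1P[<-|x0]; first by rewrite sin0 normr0.
have [|c _] := @MVT _ (@sin R) (@cos R) _ _ x0.
  by apply: continuous_subspaceT; exact: continuous_sin.
rewrite sin0 !subr0 => ->.
by rewrite normrM (gtr0_norm x0) ler_piMl ?cos_max// ltW.
Qed.

(** 0 = cos x = 1 - 2 (sin (x / 2))^2 >= 1 - x^2 / 2 at x = pi / 2. *)
Lemma sqr_pi_ge8 : 8 <= (pi : R) ^+ 2.
Proof.
have p0 := pi_gt0 R.
have h : sin (pi / 4 : R) ^+ 2 <= (pi / 4) ^+ 2.
  rewrite -real_normK ?num_real// ler_pXn2r ?nnegrE ?sin_le_id//;
    by rewrite divr_ge0// ltW.
have := cos_mulr2n (pi / 4 : R).
rewrite -[_ *+ 2]mulr_natr (_ : pi / 4 * 2%:R = pi / 2 :> R); last by field.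
rewrite cos_pihalf cos2sin2; lra.
Qed.

Lemma cos_2pin (n : nat) : cos (2 * pi * n%:R) = 1 :> R.
Proof.
rewrite (_ : 2 * pi * n%:R = 0 + pi *+ 2 *+ n); last by rewrite add0r -mulrnA -[in RHS]mulr_natr natrM; ring.
by rewrite (periodicn (@cosD2pi R)) cos0.
Qed.

Lemma sin_2pin (n : nat) : sin (2 * pi * n%:R) = 0 :> R.
Proof.
rewrite (_ : 2 * pi * n%:R = 0 + pi *+ 2 *+ n); last by rewrite add0r -mulrnA -[in RHS]mulr_natr natrM; ring.
by rewrite (periodicn (@sinD2pi R)) sin0.
Qed.

Lemma FTC_continuous (f F : R -> R) (a b : R) : a < b ->
  {within `[a, b], continuous f} -> {within `[a, b], continuous F} ->
  (forall x, a < x < b -> is_derive x 1 F (f x)) ->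
  \int[leb]_(t in `[a, b]) f t = F b - F a.
Proof.
move=> ab cf cF dF; rewrite /Rintegral (@continuous_FTC2 _ _ F) //.
  have /(continuous_within_itvP _ ab)[_ ? ?] := cF; split => //.
  by move=> x; rewrite in_itv /= => /dF h; exact: ex_derive.
by move=> x; rewrite in_itv /= => /dF h; rewrite derive1E; exact: derive_val.
Qed.

Lemma is_derive_cos_scaled (c x : R) :
  is_derive x 1 (fun t => cos (c * t)) (- (c * sin (c * x))).
Proof.
have h : is_derive x 1 (fun t : R => c * t) c.
  have -> : (fun t : R => c * t) = c \*: (@id R) by [].
  by apply: (is_derive_eq (is_deriveZ _ _)); rewrite [LHS]mulr1.
have := @is_derive1_comp _ (@cos R) (fun t => c * t) x _ _ (is_derive_cos _) h.
by move=> /is_derive_eq; apply; rewrite mulNr mulrC.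
Qed.

Lemma is_derive_sin_scaled (c x : R) :
  is_derive x 1 (fun t => sin (c * t)) (c * cos (c * x)).
Proof.
have h : is_derive x 1 (fun t : R => c * t) c.
  have -> : (fun t : R => c * t) = c \*: (@id R) by [].
  by apply: (is_derive_eq (is_deriveZ _ _)); rewrite [LHS]mulr1.
have := @is_derive1_comp _ (@sin R) (fun t => c * t) x _ _ (is_derive_sin _) h.
by move=> /is_derive_eq; apply; rewrite mulrC.
Qed.

Lemma continuous_cos_scaled (c : R) : continuous (fun t : R => cos (c * t)).
Proof.
move=> x; apply/differentiable_continuous/derivable1_diffP.
by apply: ex_derive; exact: is_derive_cos_scaled.
Qed.

Lemma continuous_sin_scaled (c : R) : continuous (fun t : R => sin (c * t)).
Proof.
move=> x; apply/differentiable_continuous/derivable1_diffP.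
by apply: ex_derive; exact: is_derive_sin_scaled.
Qed.

Lemma integral01_cos (n : nat) :
  \int[leb]_(t in `[0, 1]) cos (2 * pi * n%:R * t) = (n == 0%N)%:R.
Proof.
case: eqVneq => [->|n0].
  under eq_Rintegral do rewrite mulr0 mul0r cos0.
  by rewrite Rintegral_cst//= lebesgue_measure_itv /= lte_fin ltr01 /= oppr0 addr0 mulr1.
have c0 : 2 * pi * n%:R != 0 :> R.
  by rewrite !mulf_neq0 ?pnatr_eq0// gt_eqF// pi_gt0.
pose F t : R := (2 * pi * n%:R)^-1 * sin (2 * pi * n%:R * t).
transitivity (F 1 - F 0); last by rewrite /F mulr1 sin_2pin !mulr0 sin0 mulr0 subr0.
apply: FTC_continuous => //.
- by apply: continuous_subspaceT; exact: continuous_cos_scaled.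
- apply: continuous_subspaceT => x.
  by apply: cvgM; [exact: cvg_cst|exact: continuous_sin_scaled].
- move=> x _.
  have -> : F = (2 * pi * n%:R)^-1 \*: (fun t => sin (2 * pi * n%:R * t)) by [].
  apply: (is_derive_eq (is_deriveZ _ (is_derive_sin_scaled _ _))).
  by rewrite [LHS]mulrA mulVf// mul1r.
Qed.

Lemma integral01_sin (n : nat) :
  \int[leb]_(t in `[0, 1]) sin (2 * pi * n%:R * t) = 0.
Proof.
have [->|n0] := eqVneq n 0%N.
  under eq_Rintegral do rewrite mulr0 mul0r sin0.
  by rewrite Rintegral_cst//= mul0r.
have c0 : 2 * pi * n%:R != 0 :> R.
  by rewrite !mulf_neq0 ?pnatr_eq0// gt_eqF// pi_gt0.
pose F t : R := - (2 * pi * n%:R)^-1 * cos (2 * pi * n%:R * t).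
transitivity (F 1 - F 0); last by rewrite /F mulr1 cos_2pin !mulr0 cos0 subrr.
apply: FTC_continuous => //.
- by apply: continuous_subspaceT; exact: continuous_sin_scaled.
- apply: continuous_subspaceT => x.
  by apply: cvgM; [exact: cvg_cst|exact: continuous_cos_scaled].
- move=> x _.
  have -> : F = (- (2 * pi * n%:R)^-1) \*: (fun t => cos (2 * pi * n%:R * t)) by [].
  apply: (is_derive_eq (is_deriveZ _ (is_derive_cos_scaled _ _))).
  by rewrite [LHS]mulrNN mulrA mulVf// mul1r.
Qed.

End Trig.

Section Orthonormality.
Context {R : realType}.
Notation leb := (@lebesgue_measure R).

Lemma continuous_integrable (f : R -> R) (a b : R) :
  continuous f -> leb.-integrable `[a, b] (EFin \o f).
Proof.
move=> cf; apply: continuous_compact_integrable; first exact: segment_compact.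
exact: continuous_subspaceT.
Qed.

Lemma integral01_cosB (k m : nat) :
  \int[leb]_(t in `[0, 1]) cos (2 * pi * k%:R * t - 2 * pi * m%:R * t) = (k == m)%:R.
Proof.
wlog mk : k m / (m <= k)%N.
  move=> h; have [|/ltnW /h] := leqP m k; first exact: h.
  rewrite eq_sym => <-; apply: eq_Rintegral => t _.
  by rewrite -cosN opprB.
rewrite (_ : (k == m) = (k - m == 0)%N); last by rewrite subn_eq0 eqn_leq mk andbT.
rewrite -(integral01_cos _); apply: eq_Rintegral => t _.
by rewrite natrB//; congr cos; ring.
Qed.

Lemma integral01_sinB (k m : nat) :
  \int[leb]_(t in `[0, 1]) sin (2 * pi * k%:R * t - 2 * pi * m%:R * t) = 0.
Proof.
have [mk|/ltnW km] := leqP m k.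
  apply: (etrans _) (integral01_sin (k - m)); apply: eq_Rintegral => t _.
  by rewrite natrB//; congr sin; ring.
have e (t : R) : sin (2 * pi * k%:R * t - 2 * pi * m%:R * t) =
    - 1 * sin (2 * pi * (m - k)%:R * t).
  by rewrite mulN1r -sinN natrB//; congr sin; ring.
under eq_Rintegral do rewrite e.
rewrite RintegralZl//; first by rewrite integral01_sin mulr0.
exact/continuous_integrable/continuous_sin_scaled.
Qed.

Lemma integral01_cosD (k m : nat) :
  \int[leb]_(t in `[0, 1]) cos (2 * pi * k%:R * t + 2 * pi * m%:R * t) =
  (k + m == 0)%N%:R.
Proof.
rewrite -(integral01_cos _); apply: eq_Rintegral => t _.
by rewrite natrD; congr cos; ring.
Qed.

Lemma integral01_sinD (k m : nat) :
  \int[leb]_(t in `[0, 1]) sin (2 * pi * k%:R * t + 2 * pi * m%:R * t) = 0.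
Proof.
apply: (etrans _) (integral01_sin (k + m)); apply: eq_Rintegral => t _.
by rewrite natrD; congr sin; ring.
Qed.

Lemma continuous_phi j : continuous (@phi R j).
Proof.
rewrite /phi => x; case: (j <= 1)%N; first exact: cvg_cst.
case: (odd j).
  by apply: cvgM; [exact: cvg_cst|exact: continuous_sin_scaled].
by apply: cvgM; [exact: cvg_cst|exact: continuous_cos_scaled].
Qed.

Lemma phi_periodic j (t : R) : phi j (t + 1) = phi j t.
Proof.
rewrite /phi; case: ifP => // _.
have e : 2 * pi * (j./2)%:R * (t + 1) =
    2 * pi * (j./2)%:R * t + (pi *+ 2) *+ j./2 :> R.
  by rewrite -mulrnA -[_ *+ (2 * _)]mulr_natr natrM; ring.
by rewrite e (periodicn (@sinD2pi R)) (periodicn (@cosD2pi R)).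
Qed.

(** By the product-to-sum formulas, the products of two functions of the
    basis are combinations of trigonometric functions of frequencies
    i./2 - j./2 and i./2 + j./2, and only frequency 0 contributes. *)
Lemma phi_orthonormal i j : (0 < i)%N -> (0 < j)%N ->
  \int[leb]_(t in `[0, 1]) (phi i t * phi j t) = (i == j)%:R.
Proof.
have s2 : Num.sqrt 2 * Num.sqrt 2 = 2 :> R by rewrite -expr2 sqr_sqrtr.
wlog ij : i j / (i <= j)%N.
  move=> h i0 j0; have [|/ltnW /h] := leqP i j; first by move/h; exact.
  move=> /(_ j0 i0); rewrite eq_sym => <-; apply: eq_Rintegral => t _.
  by rewrite mulrC.
move=> i0 j0; have [i1|i1] := leqP i 1.
  have {i0 i1 ij} -> : i = 1%N by case: i i0 i1 ij => [|[]].
  have [j1|j1] := leqP j 1.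
    have -> : j = 1%N by case: j j0 j1 => [|[]].
    rewrite /phi /=; under eq_Rintegral do rewrite mulr1.
    by rewrite Rintegral_cst//= lebesgue_measure_itv /= lte_fin ltr01 /= oppr0 addr0 mulr1.
  have k0 : (j./2 == 0)%N = false by case: j j0 j1 => [|[|[]]].
  rewrite (_ : (1 == j)%N = false); last by case: j j0 j1 k0 => [|[]].
  rewrite /phi /= (leqNgt j) j1 /=.
  under eq_Rintegral do rewrite mul1r.
  case: (odd j).
    rewrite RintegralZl ?integral01_sin ?mulr0//.
    exact/continuous_integrable/continuous_sin_scaled.
  rewrite RintegralZl ?integral01_cos ?k0 ?mulr0//.
  exact/continuous_integrable/continuous_cos_scaled.
have j1 : (1 < j)%N by exact: leq_trans ij.
have kij : (i./2 + j./2 == 0)%N = false by case: i i0 i1 ij => [|[|[]]].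
have cD : continuous (fun t : R => cos (2 * pi * i./2%:R * t + 2 * pi * j./2%:R * t)).
  move=> x; rewrite (_ : (fun t : R => _) = (fun t => cos (2 * pi * (i./2 + j./2)%:R * t))).
    exact: continuous_cos_scaled.
  by apply/funext => t; rewrite natrD; congr cos; ring.
have cB : continuous (fun t : R => cos (2 * pi * i./2%:R * t - 2 * pi * j./2%:R * t)).
  move=> x; rewrite (_ : (fun t : R => _) =
      (fun t => cos ((2 * pi * i./2%:R - 2 * pi * j./2%:R) * t))).
    exact: continuous_cos_scaled.
  by apply/funext => t; congr cos; ring.
have sD : continuous (fun t : R => sin (2 * pi * i./2%:R * t + 2 * pi * j./2%:R * t)).
  move=> x; rewrite (_ : (fun t : R => _) = (fun t => sin (2 * pi * (i./2 + j./2)%:R * t))).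
    exact: continuous_sin_scaled.
  by apply/funext => t; rewrite natrD; congr sin; ring.
have sB : continuous (fun t : R => sin (2 * pi * i./2%:R * t - 2 * pi * j./2%:R * t)).
  move=> x; rewrite (_ : (fun t : R => _) =
      (fun t => sin ((2 * pi * i./2%:R - 2 * pi * j./2%:R) * t))).
    exact: continuous_sin_scaled.
  by apply/funext => t; congr sin; ring.
rewrite /phi !(leqNgt _ 1) i1 j1 /=.
have hij : (i == j) = (odd i == odd j) && (i./2 == j./2).
  apply/eqP/andP => [->//|[/eqP o /eqP h]].
  by rewrite -(odd_double_half i) -(odd_double_half j) o h.
rewrite hij.
case: (odd i); case: (odd j) => /=.
- transitivity (\int[leb]_(t in `[0, 1])
    (cos (2 * pi * i./2%:R * t - 2 * pi * j./2%:R * t) -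
     cos (2 * pi * i./2%:R * t + 2 * pi * j./2%:R * t))).
    by apply: eq_Rintegral => t _; rewrite cosB cosD mulrACA s2; ring.
  rewrite RintegralB//; try exact: continuous_integrable.
  by rewrite integral01_cosB integral01_cosD kij subr0.
- transitivity (\int[leb]_(t in `[0, 1])
    (sin (2 * pi * i./2%:R * t + 2 * pi * j./2%:R * t) +
     sin (2 * pi * i./2%:R * t - 2 * pi * j./2%:R * t))).
    by apply: eq_Rintegral => t _; rewrite sinB sinD mulrACA s2; ring.
  rewrite RintegralD//; try exact: continuous_integrable.
  by rewrite integral01_sinB integral01_sinD addr0.
- transitivity (\int[leb]_(t in `[0, 1])
    (sin (2 * pi * i./2%:R * t + 2 * pi * j./2%:R * t) -
     sin (2 * pi * i./2%:R * t - 2 * pi * j./2%:R * t))).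
    by apply: eq_Rintegral => t _; rewrite sinB sinD mulrACA s2; ring.
  rewrite RintegralB//; try exact: continuous_integrable.
  by rewrite integral01_sinB integral01_sinD subr0.
- transitivity (\int[leb]_(t in `[0, 1])
    (cos (2 * pi * i./2%:R * t - 2 * pi * j./2%:R * t) +
     cos (2 * pi * i./2%:R * t + 2 * pi * j./2%:R * t))).
    by apply: eq_Rintegral => t _; rewrite cosB cosD mulrACA s2; ring.
  rewrite RintegralD//; try exact: continuous_integrable.
  by rewrite integral01_cosB integral01_cosD kij addr0.
Qed.

(** The primitive is normalized to vanish at both ends of the period: the
    signal may jump at the integers, and integration by parts must leave no
    boundary term.  For sines it is proportional to 1 - cos, whence a factor 2
    in the bound. *)
Lemma phi_primitive j : (1 < j)%N -> exists P : R -> R,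
  [/\ forall x : R, is_derive x 1 P (phi j x), P 0 = 0, P 1 = 0 &
      forall x, `|P x| <= Num.sqrt 2 / (pi * j./2%:R)].
Proof.
move=> j1; have k0 : 0 < j./2%:R :> R.
  by rewrite ltr0n half_gt0.
have c0 : 0 < 2 * pi * j./2%:R :> R by rewrite !mulr_gt0// pi_gt0.
have s20 : 0 <= Num.sqrt 2 :> R by rewrite sqrtr_ge0.
have twoE : Num.sqrt 2 / (pi * j./2%:R) = Num.sqrt 2 / (2 * pi * j./2%:R) * 2 :> R.
  have := gt_eqF (pi_gt0 R); have := gt_eqF k0.
  move: (pi : R) (j./2%:R : R) => p q q0 p0; field; by rewrite q0 p0.
have K0 : 0 <= Num.sqrt 2 / (2 * pi * j./2%:R) :> R by rewrite divr_ge0 ?(ltW c0).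
rewrite twoE /phi leqNgt j1 /=; case: (odd j).
- exists (fun x => - (Num.sqrt 2 / (2 * pi * j./2%:R)) * (cos (2 * pi * j./2%:R * x) - 1)).
  split.
  + move=> x.
    have -> : (fun x : R => - (Num.sqrt 2 / (2 * pi * j./2%:R)) *
        (cos (2 * pi * j./2%:R * x) - 1)) =
        (- (Num.sqrt 2 / (2 * pi * j./2%:R))) \*:
        ((fun x => cos (2 * pi * j./2%:R * x)) - (cst 1)) by [].
    apply: (is_derive_eq (is_deriveZ _ (is_deriveB (is_derive_cos_scaled _ _)
       (is_derive_cst _ _ _)))).
    rewrite subr0 [LHS]mulrNN mulrA mulfVK// gt_eqF//.
  + by rewrite mulr0 cos0 subrr mulr0.
  + by rewrite mulr1 cos_2pin subrr mulr0.
  + move=> x; rewrite normrM normrN (ger0_norm K0) ler_wpM2l//.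
    by rewrite (le_trans (ler_normB _ _))// normr1 lerD2r cos_max.
- exists (fun x => Num.sqrt 2 / (2 * pi * j./2%:R) * sin (2 * pi * j./2%:R * x)).
  split.
  + move=> x.
    have -> : (fun x : R => Num.sqrt 2 / (2 * pi * j./2%:R) * sin (2 * pi * j./2%:R * x))
      = (Num.sqrt 2 / (2 * pi * j./2%:R)) \*: (fun x => sin (2 * pi * j./2%:R * x)) by [].
    apply: (is_derive_eq (is_deriveZ _ (is_derive_sin_scaled _ _))).
    rewrite [LHS]mulrA mulfVK// gt_eqF//.
  + by rewrite mulr0 sin0 mulr0.
  + by rewrite mulr1 sin_2pin mulr0.
  + move=> x; rewrite normrM (ger0_norm K0) ler_wpM2l//.
    by rewrite (le_trans (sin_max _))// ler1n.
Qed.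

End Orthonormality.

(** * Continuously differentiable signals *)

Section WithinContinuous.
Context {R : realType} (A : set R) (f g : R -> R).

Lemma within_continuousM : {within A, continuous f} ->
  {within A, continuous g} -> {within A, continuous (fun t => f t * g t)}.
Proof.
move=> /subspace_continuousP cf /subspace_continuousP cg.
apply/subspace_continuousP => x Ax; apply: cvgM; [exact: cf|exact: cg].
Qed.

Lemma within_continuousD : {within A, continuous f} ->
  {within A, continuous g} -> {within A, continuous (fun t => f t + g t)}.
Proof.
move=> /subspace_continuousP cf /subspace_continuousP cg.
apply/subspace_continuousP => x Ax; apply: cvgD; [exact: cf|exact: cg].
Qed.

End WithinContinuous.

Section Signal.
Context {R : realType} (S dS : R -> R).
Notation leb := (@lebesgue_measure R).
Hypotheses (HC : C1_signal S dS) (HD : (L1norm dS < +oo)%E).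

Lemma C1_signal_derive (t : R) : 0 < t < 1 -> is_derive t 1 S (dS t).
Proof.
move=> /andP[t0 t1]; have [/(_ t)] := HC; rewrite (ltW t0) t1 => /(_ isT) h _.
have {}h : h^-1 *: ((S \o shift t) (h *: (1 : R)) - S t) @[h --> 0^'] --> dS t.
  move/cvgrPdist_lt : h => h; apply/cvgrPdist_lt => e /h.
  rewrite near_withinE => {}h.
  have : \forall h \near (0 : R)^', 0 <= t + h < 1.
    near=> u.
    have : `|u| < Num.min t (1 - t).
      near: u; apply: dnbhs0_lt; rewrite lt_min t0 subr_gt0 //.
    rewrite lt_min !ltr_norml => /andP[/andP[? ?] /andP[? ?]]; lra.
  move: h; apply: filterS2 => u h1 h2.
  by rewrite /= [_ *: 1]mulr1 (addrC u); exact: h1.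
split; first exact: cvgP h.
exact: cvg_lim h.
Unshelve. all: end_near. Qed.

(** S h - S 0 is h times a difference quotient that converges. *)
Lemma C1_signal_right0 : S h @[h --> 0^'+] --> S 0.
Proof.
have [/(_ 0)] := HC; rewrite lexx ltr01 => /(_ isT) h _.
have {}h : h^-1 * (S h - S 0) @[h --> (0 : R)^'+] --> dS 0.
  move/cvgrPdist_lt : h => h; apply/cvgrPdist_lt => e /h.
  rewrite near_withinE => {}h.
  have {}h : \forall x \near (0 : R)^'+, 0 <= 0 + x < 1 ->
      `|dS 0 - x^-1 * (S (0 + x) - S 0)| < e by move: h; apply: within_subset => r ?; rewrite gt_eqF.
  have h2 : \forall x \near (0 : R)^'+, 0 <= x < 1.
    near=> u; apply/andP; split; near: u; first exact: nbhs_right_ge.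
    exact: nbhs_right_lt.
  by move: h h2; apply: filterS2 => u; rewrite add0r.
have id0 : (x : R) @[x --> (0:R)^'+] --> (0:R) by exact: cvg_at_right_filter.
have : u * (u^-1 * (S u - S 0)) + S 0 @[u --> (0:R)^'+] --> 0 * dS 0 + S 0.
  by apply: cvgD; [exact: cvgM|exact: cvg_cst].
rewrite mul0r add0r => h3.
apply: cvg_trans h3; apply: near_eq_cvg; near=> u => /=.
have u0 : u != 0 by near: u; exact: nbhs_right_neq.
by rewrite [u * _]mulrA mulfV// mul1r subrK.
Unshelve. all: end_near. Qed.

Lemma C1_signal_continuous (b : R) : 0 < b < 1 -> {within `[0, b], continuous S}.
Proof.
move=> /andP[b0 b1]; apply/(continuous_within_itvP _ b0).
have c x : 0 < x < 1 -> {for x, continuous S}.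
  move=> /C1_signal_derive h.
  by apply/differentiable_continuous/derivable1_diffP; exact: ex_derive.
split; [|exact: C1_signal_right0|apply: cvg_at_left_filter; apply: c; lra].
by move=> x; rewrite in_itv /= => /andP[x0 xb]; apply: c; lra.
Qed.

Lemma dS_continuous (b : R) : b < 1 -> {within `[0, b], continuous dS}.
Proof.
move=> b1; have [_] := HC; apply: continuous_subspaceW => x /=.
by rewrite !in_itv /= => /andP[-> /le_lt_trans]; apply.
Qed.

Lemma measurable_dS : measurable_fun `[(0:R), (1:R)[ dS.
Proof. by apply: subspace_continuous_measurable_fun => //; case: HC. Qed.

Lemma integrable_dS : leb.-integrable `[(0:R), (1:R)[ (EFin \o dS).
Proof.
apply/integrableP; split; first by apply/measurable_EFinP; exact: measurable_dS.
exact: HD.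
Qed.

Let D := fine (L1norm dS).

Lemma L1norm_ge0 : 0 <= D.
Proof. by apply: fine_ge0; apply: integral_ge0 => x _; rewrite lee_fin. Qed.

Lemma integral_dS_le (P : R -> R) (b K : R) : 0 < b < 1 -> 0 <= K ->
  continuous P -> (forall x, `|P x| <= K) ->
  `|\int[leb]_(t in `[0, b]) (dS t * P t)| <= K * D.
Proof.
move=> /andP[b0 b1] K0 cP PK.
have sub : `[0, b] `<=` `[0, (1:R)[.
  by move=> x /=; rewrite !in_itv /= => /andP[-> /le_lt_trans]; apply.
have idS : leb.-integrable `[0, b] (EFin \o dS).
  by apply: integrableS integrable_dS.
have iadS : leb.-integrable `[0, b] (EFin \o (fun t => `|dS t|)).
  exact: integrable_abse idS.
have idSP : leb.-integrable `[0, b] (EFin \o (fun t => dS t * P t)).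
  apply: continuous_compact_integrable; first exact: segment_compact.
  by apply: within_continuousM; [exact: dS_continuous|exact: continuous_subspaceT].
apply: le_trans (le_normr_Rintegral _ _) _ => //.
apply: le_trans (_ : \int[leb]_(t in `[0, b]) (K * `|dS t|) <= _).
  apply: le_Rintegral => //; first exact: (integrable_abse idSP).
    exact: (integrableZl _ K iadS).
  by move=> x _; rewrite normrM mulrC ler_wpM2r.
rewrite RintegralZl// ler_wpM2l// /D fine_le//.
- exact: (integrable_fin_num _ iadS).
- by rewrite ge0_fin_numE// integral_ge0// => x _; rewrite lee_fin.
- apply: ge0_subset_integral => //.
  by apply/measurable_EFinP; apply: measurableT_comp => //; exact: measurable_dS.
Qed.

Lemma signal_by_parts (f P : R -> R) (b : R) : 0 < b < 1 ->
  continuous f -> (forall x : R, is_derive x 1 P (f x)) ->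
  \int[leb]_(t in `[0, b]) (f t * S t) =
  S b * P b - S 0 * P 0 - \int[leb]_(t in `[0, b]) (dS t * P t).
Proof.
move=> b01 cf dP; have /andP[b0 b1] := b01.
have cP : continuous P.
  move=> x; apply/differentiable_continuous/derivable1_diffP.
  exact: (@ex_derive _ _ _ _ _ _ _ (dP x)).
have c1 : {within `[0, b], continuous (fun t => dS t * P t)}.
  by apply: within_continuousM; [exact: dS_continuous|exact: continuous_subspaceT].
have c2 : {within `[0, b], continuous (fun t => f t * S t)}.
  apply: within_continuousM; [exact: continuous_subspaceT|].
  exact: C1_signal_continuous.
apply/eqP; rewrite eq_sym subr_eq eq_sym; apply/eqP.
rewrite -RintegralD//; last first.
- by apply: continuous_compact_integrable; first exact: segment_compact.
- by apply: continuous_compact_integrable; first exact: segment_compact.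
apply: (@FTC_continuous _ _ (fun t => S t * P t)) => //.
- exact: within_continuousD.
- apply: within_continuousM; [exact: C1_signal_continuous|].
  exact: continuous_subspaceT.
- move=> x /andP[x0 xb].
  have hx : is_derive x 1 S (dS x) by apply: C1_signal_derive; lra.
  apply: (is_derive_eq (@is_deriveM _ _ S P x 1 _ _ hx (dP x))).
  by congr (_ + _); exact: mulrC.
Qed.

(** Integration by parts with the constant 1, a primitive of 0. *)
Lemma signal_bound (b : R) : 0 < b < 1 -> `|S b| <= `|S 0| + D.
Proof.
move=> b01.
have d1 (x : R) : is_derive x 1 (cst 1 : R -> R) 0 by exact: is_derive_cst.
have := @signal_by_parts (cst 0) (cst 1) b b01 (@cst_continuous _ _ _) d1.
under eq_Rintegral do rewrite mul0r.
rewrite Rintegral_cst//= mul0r !mulr1 => h.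
have -> : S b = S 0 + \int[leb]_(t in `[0, b]) (dS t * cst 1 t) by lra.
apply: le_trans (ler_normD _ _) _; rewrite lerD2l -[leRHS]mul1r.
apply: integral_dS_le => //; first by move=> x; exact: cvg_cst.
by move=> x; rewrite normr1.
Qed.

End Signal.

(** * Square integrable and periodic functions *)

Section RintegralSum.
Context {d : measure_display} {T : measurableType d} {R : realType}
  {mu : {measure set T -> \bar R}} {E : set T} (mE : measurable E).

Lemma integrableZ (c : R) (f : T -> R) : mu.-integrable E (EFin \o f) ->
  mu.-integrable E (EFin \o (fun x => c * f x)).
Proof. exact: integrableZl. Qed.

Lemma integrable_add (f g : T -> R) : mu.-integrable E (EFin \o f) ->
  mu.-integrable E (EFin \o g) -> mu.-integrable E (EFin \o (fun x => f x + g x)).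
Proof. by move=> hf hg; exact: (integrableD mE hf hg). Qed.

Lemma integrable_sub (f g : T -> R) : mu.-integrable E (EFin \o f) ->
  mu.-integrable E (EFin \o g) -> mu.-integrable E (EFin \o (fun x => f x - g x)).
Proof. by move=> hf hg; exact: (integrableB mE hf hg). Qed.

Lemma integrable_bigsum (I : Type) (r : seq I) (F : I -> T -> R) :
  (forall i, mu.-integrable E (EFin \o F i)) ->
  mu.-integrable E (EFin \o (fun x => \sum_(i <- r) F i x)).
Proof.
move=> iF; elim: r => [|i r IH].
  apply: (eq_integrable _ (cst 0%E)) => //; last exact: integrable0.
  by move=> x _ /=; rewrite big_nil.
apply: (eq_integrable _ (EFin \o (fun x => F i x + \sum_(j <- r) F j x))) => //.
  by move=> x _ /=; rewrite big_cons.
exact: integrable_add.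
Qed.

Lemma Rintegral_bigsum (I : Type) (r : seq I) (F : I -> T -> R) :
  (forall i, mu.-integrable E (EFin \o F i)) ->
  \int[mu]_(x in E) (\sum_(i <- r) F i x) = \sum_(i <- r) \int[mu]_(x in E) F i x.
Proof.
move=> iF; elim: r => [|i r IH].
  rewrite big_nil; under eq_Rintegral do rewrite big_nil.
  by rewrite Rintegral_cst// mul0r.
rewrite big_cons -IH -RintegralD//; last exact: integrable_bigsum.
by apply: eq_Rintegral => x _; rewrite big_cons.
Qed.

Lemma Rintegral_lin_bigsum (I : Type) (r : seq I) (c : I -> R) (F : I -> T -> R) :
  (forall i, mu.-integrable E (EFin \o F i)) ->
  \int[mu]_(x in E) (\sum_(i <- r) c i * F i x) =
  \sum_(i <- r) c i * \int[mu]_(x in E) F i x.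
Proof.
move=> iF; rewrite Rintegral_bigsum; last by move=> i; exact: integrableZ.
by apply: eq_bigr => i _; rewrite RintegralZl.
Qed.

End RintegralSum.

Section L2Space.
Context {R : realType}.
Notation leb := (@lebesgue_measure R).

(** |f g| <= f^2 + g^2. *)
Lemma L2_integrableM (T : R) (f g : R -> R) : L2 T f -> L2 T g ->
  leb.-integrable `[0, T] (EFin \o (fun t => f t * g t)).
Proof.
move=> [mf If] [mg Ig].
have i2 (h : R -> R) : measurable_fun `[0, T] h ->
    (\int[leb]_(t in `[0%R, T]) ((h t) ^+ 2)%:E < +oo)%E ->
    leb.-integrable `[0, T] (EFin \o (fun t => h t ^+ 2)).
  move=> mh Ih; apply/integrableP; split.
    by apply/measurable_EFinP; exact: measurable_funX.
  apply: le_lt_trans Ih; rewrite le_eqVlt; apply/orP; left; apply/eqP.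
  by apply: eq_integral => t _ /=; rewrite ger0_norm ?sqr_ge0.
have : leb.-integrable `[0, T] (EFin \o (fun t => f t ^+ 2 + g t ^+ 2)).
  by apply: integrable_add => //; exact: i2.
apply: le_integrable => //.
  by apply/measurable_EFinP; exact: measurable_funM.
move=> t _ /=; rewrite lee_fin [leRHS]ger0_norm ?addr_ge0 ?sqr_ge0//.
rewrite normrM -[f t ^+ 2]real_normK ?num_real// -[g t ^+ 2]real_normK ?num_real//.
have := sqr_ge0 (`|f t| - `|g t|); rewrite sqrrB.
have : 0 <= `|f t| * `|g t| by rewrite mulr_ge0.
by lra.
Qed.

Lemma continuous_L2 (T : R) (f : R -> R) : continuous f -> L2 T f.
Proof.
move=> cf; split.
  by apply: measurable_funTS; exact: continuous_measurable_fun.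
have c2 : continuous (fun t => f t ^+ 2).
  by move=> x; rewrite /=; under eq_fun do rewrite expr2; apply: cvgM; exact: cf.
have := continuous_integrable _ 0 T c2 => /integrableP[_]; apply: le_lt_trans.
rewrite le_eqVlt; apply/orP; left; apply/eqP.
by apply: eq_integral => t _ /=; rewrite ger0_norm ?sqr_ge0.
Qed.

Lemma L2_sqr (T : R) (f : R -> R) : L2 T f ->
  (\int[leb]_(t in `[0%R, T]) ((f t) ^+ 2)%:E =
   (\int[leb]_(t in `[0, T]) (f t ^+ 2))%:E)%E.
Proof.
move=> [_ h]; rewrite /Rintegral fineK// ge0_fin_numE//.
by apply: integral_ge0 => t _; rewrite lee_fin sqr_ge0.
Qed.

Lemma measurable_shift (c : R) :
  measurable_fun [set: measurableTypeR R]
    (fun x : measurableTypeR R => (x : R) + c : measurableTypeR R).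
Proof. by apply: measurable_funD => //; exact: measurable_cst. Qed.

(** A measure that gives intervals their length is the Lebesgue measure. *)
Lemma lebesgue_measure_shift (c : R) (A : set R) : measurable A ->
  pushforward leb (fun x : R => x + c : measurableTypeR R) A = leb A.
Proof.
move=> mA; apply/esym/lebesgue_measure_unique => //=.
  exact: measurable_shift.
move=> mf _ [[a b]] _ <-.
rewrite /pushforward (_ : _ @^-1` _ = `]a - c, b - c]%classic).
  rewrite !lebesgue_measure_itv/= !lte_fin ltrD2r.
  by case: ifP => // _; congr EFin; ring.
by apply/seteqP; split => x /=; rewrite !in_itv /= ltrBlDr lerBrDr.
Qed.

Lemma preimage_shift_itv (a b c : R) :
  (fun x : R => x + c) @^-1` `]a + c, b + c] = `]a, b]%classic.
Proof. by apply/seteqP; split => x /=; rewrite !in_itv /= ltrD2r lerD2r. Qed.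

Lemma integrable_shift (f : R -> R) (a b c : R) :
  leb.-integrable `]a, b] (EFin \o (fun x => f (x + c))) ->
  leb.-integrable `]a + c, b + c] (EFin \o f) /\
  \int[leb]_(x in `]a + c, b + c]) f x = \int[leb]_(x in `]a, b]) f (x + c).
Proof.
move=> If; pose D := `]a + c, b + c]%classic : set R.
have mD : measurable (D : set (measurableTypeR R)) by exact: measurable_itv.
have mf : measurable_fun D f.
  have -> : f = (fun x => f (x + c)) \o (fun x : R => x + (- c)).
    by apply/funext => x /=; rewrite subrK.
  apply: (measurable_comp (F := `]a, b]%classic)) => //.
  - move=> y /= [x + <-]; rewrite /D /= !in_itv /= => /andP[ax xb].
    by rewrite ltrBrDr ax lerBlDr.
  - by move/integrableP : If => [/measurable_EFinP].
  - by apply: measurable_funTS; exact: measurable_shift.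
have e (h : R -> \bar R) : (\int[leb]_(x in D) h x =
    \int[pushforward leb (fun x : R => (x + c)%R : measurableTypeR R)]_(x in D) h x)%E.
  apply: eq_measure_integral => //=; first exact: measurable_shift.
  by move=> mp A mA _; exact/esym/lebesgue_measure_shift.
pose g : R -> \bar R := (EFin \o f) \_ D.
have mg : measurable_fun [set: measurableTypeR R] g.
  by apply/(measurable_restrictT _ mD); exact/measurable_EFinP.
have gE x : D x -> g x = (f x)%:E by move=> Dx; rewrite /g patchE mem_set.
have Ig : leb.-integrable ((fun x : R => x + c : measurableTypeR R) @^-1` D)
    (g \o (fun x : R => x + c)).
  rewrite preimage_shift_itv; apply: eq_integrable If => // x.
  rewrite inE /= => xab; rewrite gE//.
  by move: xab; rewrite /D /= !in_itv /= ltrD2r lerD2r.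
have H := integral_pushforward (measurable_shift c) mg Ig mD.
have H0 := integrable_pushforward (measurable_shift c) mg Ig mD.
split.
  apply: (eq_integrable mD g) => [x|]; first by rewrite inE => /gE ->.
  apply/integrableP; split; first exact: measurable_funTS.
  by rewrite e; case/integrableP : H0.
rewrite /Rintegral; congr fine.
transitivity (\int[leb]_(x in D) g x)%E.
  by apply: eq_integral => x; rewrite inE => /gE ->.
rewrite e H preimage_shift_itv; apply: eq_integral => x; rewrite inE /= => xab.
by rewrite gE// /D /=; move: xab; rewrite !in_itv /= ltrD2r lerD2r.
Qed.

Lemma periodic_integral (f : R -> R) (n : nat) :
  (forall t, f (t + 1) = f t) -> leb.-integrable `[0, 1] (EFin \o f) ->
  leb.-integrable `[0, n%:R] (EFin \o f) /\
  \int[leb]_(t in `[0, n%:R]) f t = n%:R * \int[leb]_(t in `[0, 1]) f t.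
Proof.
move=> fP I1; have I1' : leb.-integrable `]0, 1] (EFin \o f).
  apply: integrableS I1 => //; exact: subset_itv_oc_cc.
have fn x m : f (x + m%:R) = f x.
  elim: m => [|m IH]; first by rewrite addr0.
  by rewrite -natr1 addrA fP.
elim: n => [|n [IH1 IH2]].
  rewrite set_itv1 Rintegral_set1 mul0r; split => //.
  apply/integrableP; split; first exact: measurable_fun_set1.
  by rewrite integral_set1.
have [J1 J2] : leb.-integrable `](n%:R : R), n.+1%:R] (EFin \o f) /\
    \int[leb]_(t in `]n%:R, n.+1%:R]) f t = \int[leb]_(t in `[0, 1]) f t.
  have := @integrable_shift f 0 1 n%:R.
  have -> : (fun x => f (x + n%:R)) = f by apply/funext => x; exact: fn.
  rewrite add0r nat1r => /(_ I1')[? ->]; split => //.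
  by rewrite Rintegral_itv_obnd_cbnd.
have U : `[0, n.+1%:R]%classic = `[0, n%:R] `|` `](n%:R:R), n.+1%:R].
  by apply: itv_bndbnd_setU; rewrite bnd_simp ?ler0n ?ler_nat.
have dj : [disjoint `[0, n%:R]%classic & `](n%:R:R), n.+1%:R]%classic].
  apply/disj_set2P; rewrite -subset0 => z/=; rewrite !in_itv/= => -[/andP[_ +]].
  by rewrite leNgt => /negbTE ->.
have I : leb.-integrable (`[0, n%:R] `|` `](n%:R:R), n.+1%:R]) (EFin \o f).
  move/integrableP : (IH1) => [m1 i1]; move/integrableP : (J1) => [m2 i2].
  have mU : measurable_fun (`[0, n%:R] `|` `](n%:R:R), n.+1%:R]) (EFin \o f).
    exact/measurable_funU.
  apply/integrableP; split => //.
  rewrite ge0_integral_setU//; first exact: lte_add_pinfty.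
  exact: measurableT_comp.
by rewrite U; split => //; rewrite Rintegral_setU// IH2 J2 -natr1 mulrDl mul1r.
Qed.

End L2Space.

(** * Fourier coefficients *)

Section Fourier.
Context {R : realType}.
Notation leb := (@lebesgue_measure R).
Implicit Types (S : R -> R) (c : nat -> R) (r : seq nat).

Definition theta S (j : nat) : R := \int[leb]_(t in `[0, 1]) (phi j t * S t).

Lemma phi_L2 (T : R) j : L2 T (@phi R j).
Proof. by apply: continuous_L2; exact: continuous_phi. Qed.

Lemma continuous_trig r c : continuous (fun t : R => \sum_(j <- r) c j * phi j t).
Proof.
elim: r => [|j r IH] x.
  under eq_fun do rewrite big_nil; exact: cvg_cst.
under eq_fun do rewrite big_cons.
apply: cvgD; last exact: IH.
by apply: cvgM; [exact: cvg_cst|exact: continuous_phi].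
Qed.

Lemma integral_trig_sqr r c : uniq r -> {in r, forall j, 0 < j}%N ->
  \int[leb]_(t in `[0, 1]) ((\sum_(j <- r) c j * phi j t) ^+ 2) =
  \sum_(j <- r) c j ^+ 2.
Proof.
move=> ur r0.
have ii i j : leb.-integrable `[0, 1] (EFin \o (fun t => phi i t * phi j t)).
  by apply: L2_integrableM; exact: phi_L2.
transitivity (\int[leb]_(t in `[0, 1])
   (\sum_(i <- r) c i * \sum_(j <- r) c j * (phi i t * phi j t))).
  apply: eq_Rintegral => t _; rewrite expr2 mulr_suml; apply: eq_bigr => i _.
  rewrite -mulrA; congr (_ * _); rewrite mulr_sumr; apply: eq_bigr => j _.
  by rewrite mulrCA.
rewrite Rintegral_lin_bigsum//; last first.
  move=> i; apply: integrable_bigsum => // j; exact: integrableZ.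
rewrite big_seq [RHS]big_seq; apply: eq_bigr => i ir.
rewrite Rintegral_lin_bigsum// (bigD1_seq i)//= phi_orthonormal ?r0//.
rewrite eqxx mulr1 big_seq_cond big1 ?addr0// => j /andP[jr /negbTE ji].
by rewrite phi_orthonormal ?r0// eq_sym ji mulr0.
Qed.

Lemma integral_trig_err S r c : uniq r -> {in r, forall j, 0 < j}%N -> L2 1 S ->
  \int[leb]_(t in `[0, 1]) (\sum_(j <- r) c j * phi j t - S t) ^+ 2 =
  \sum_(j <- r) c j ^+ 2 - 2 * (\sum_(j <- r) c j * theta S j)
  + \int[leb]_(t in `[0, 1]) (S t ^+ 2).
Proof.
move=> ur r0 LS.
have iS2 : leb.-integrable `[0, 1] (EFin \o (fun t => S t ^+ 2)).
  exact: L2_integrableM.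
have LG := continuous_L2 1 _ (continuous_trig r c).
have iG2 : leb.-integrable `[0, 1] (EFin \o (fun t => (\sum_(j <- r) c j * phi j t) ^+ 2)).
  exact: L2_integrableM.
have ip j : leb.-integrable `[0, 1] (EFin \o (fun t => phi j t * S t)).
  by apply: L2_integrableM => //; exact: phi_L2.
have iGS : leb.-integrable `[0, 1]
   (EFin \o (fun t => \sum_(j <- r) c j * (phi j t * S t))).
  by apply: integrable_bigsum => // j; exact: integrableZ.
transitivity (\int[leb]_(t in `[0, 1])
   ((\sum_(j <- r) c j * phi j t) ^+ 2
    - 2 * (\sum_(j <- r) c j * (phi j t * S t)) + S t ^+ 2)).
  apply: eq_Rintegral => t _.
  have -> : \sum_(j <- r) c j * (phi j t * S t) = (\sum_(j <- r) c j * phi j t) * S t.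
    by rewrite mulr_suml; apply: eq_bigr => j _; rewrite mulrA.
  by ring.
have iGS2 : leb.-integrable `[0, 1]
   (EFin \o (fun t => 2 * \sum_(j <- r) c j * (phi j t * S t))).
  exact: integrableZ.
rewrite RintegralD//; last exact: integrable_sub.
rewrite RintegralB// RintegralZl// Rintegral_lin_bigsum//.
by rewrite integral_trig_sqr.
Qed.

Lemma bessel S r : uniq r -> {in r, forall j, 0 < j}%N -> L2 1 S ->
  \sum_(j <- r) theta S j ^+ 2 <= \int[leb]_(t in `[0, 1]) (S t ^+ 2).
Proof.
move=> ur r0 LS; have := @integral_trig_err S r (theta S) ur r0 LS.
have : 0 <= \int[leb]_(t in `[0, 1]) (\sum_(j <- r) theta S j * phi j t - S t) ^+ 2.
  by apply: Rintegral_ge0 => t _; exact: sqr_ge0.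
move=> + e; rewrite e.
have -> : \sum_(j <- r) theta S j * theta S j = \sum_(j <- r) theta S j ^+ 2 by [].
lra.
Qed.

Lemma integral_trig_sqr_period (n : nat) r c : uniq r -> {in r, forall j, 0 < j}%N ->
  \int[leb]_(t in `[0, n%:R]) ((\sum_(j <- r) c j * phi j t) ^+ 2) =
  n%:R * \sum_(j <- r) c j ^+ 2.
Proof.
move=> ur r0; rewrite -integral_trig_sqr//.
have LG := continuous_L2 1 _ (continuous_trig r c).
apply: (periodic_integral _ n _ _).2; last exact: L2_integrableM.
move=> t; congr (_ ^+ 2); apply: eq_bigr => j _; by rewrite phi_periodic.
Qed.

Lemma integral_phi_signal S (n j : nat) : (forall t, S (t + 1) = S t) -> L2 1 S ->
  \int[leb]_(t in `[0, n%:R]) (phi j t * S t) = n%:R * theta S j.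
Proof.
move=> SP LS; apply: (periodic_integral _ n _ _).2.
  by move=> t; rewrite SP phi_periodic.
by apply: L2_integrableM => //; exact: phi_L2.
Qed.

(** The derivative is only controlled on [0, 1[, so the integration by parts
    takes place on [0, b] with b < 1; the boundary term S b * P b tends to 0
    because S is bounded on [0, 1[ and P 1 = 0. *)
Lemma theta_le (S dS : R -> R) j : C1_signal S dS -> (L1norm dS < +oo)%E ->
  L2 1 S -> (1 < j)%N ->
  `|theta S j| <= Num.sqrt 2 / (pi * j./2%:R) * fine (L1norm dS).
Proof.
move=> HC HD LS j1; set D := fine _; set K := Num.sqrt 2 / _.
have [P [dP P0 P1 PK]] := @phi_primitive R j j1.
have cP : continuous P.
  move=> x; apply/differentiable_continuous/derivable1_diffP.
  exact: (@ex_derive _ _ _ _ _ _ _ (dP x)).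
have K0 : 0 <= K by rewrite divr_ge0 ?sqrtr_ge0// mulr_ge0 ?ler0n// pi_ge0.
have ip : leb.-integrable `[0, 1] (EFin \o (fun t => phi j t * S t)).
  by apply: L2_integrableM => //; exact: phi_L2.
have c1 := parameterized_integral_cvg_at_left ltr01 ip.
have {}c1 := cvg_norm c1.
have c2 : (`|S 0| + D) * `|P b| + K * D @[b --> (1:R)^'-]
    --> (`|S 0| + D) * `|P 1| + K * D.
  apply: cvgD; last exact: cvg_cst.
  apply: cvgM; first exact: cvg_cst.
  by apply: cvg_norm; apply: cvg_at_left_filter; exact: cP.
move: c2; rewrite P1 normr0 mulr0 add0r => c2.
apply: (ler_cvg_to (c1 _) c2).
near=> b.
have b01 : 0 < b < 1.
  by apply/andP; split; near: b; [exact: nbhs_left_gt|exact: nbhs_left_lt].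
rewrite /parameterized_integral (signal_by_parts _ _ HC _ _ _ b01 (@continuous_phi R j) dP).
rewrite P0 mulr0 subr0; apply: le_trans (ler_normB _ _) _.
rewrite lerD//; last exact: (integral_dS_le S).
by rewrite normrM ler_wpM2r//; exact: signal_bound.
Unshelve. all: end_near. Qed.

(** The frequency of phi m.+1 is at least m / 2 and pi^2 >= 8, so the
    coefficient is at most |dS|_1 / m; twice the difference of inverses
    dominates 1 / m^2 and makes the sum over m telescope. *)
Lemma theta_sqr_le (S dS : R -> R) m : C1_signal S dS -> (L1norm dS < +oo)%E ->
  L2 1 S -> (0 < m)%N ->
  theta S m.+1 ^+ 2 <= 2 * (m%:R^-1 - m.+1%:R^-1) * fine (L1norm dS) ^+ 2.
Proof.
move=> HC HD LS m0; have j1 : (1 < m.+1)%N by [].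
have := @theta_le S dS m.+1 HC HD LS j1; set D := fine _.
set k := m.+1./2 => h.
have k0 : 0 < k%:R :> R by rewrite ltr0n half_gt0.
have mk : m%:R <= 2 * k%:R :> R.
  rewrite -natrM ler_nat mul2n /k -[X in (X <= _)%N]odd_double_half -uphalfE.
  by rewrite uphalf_half doubleD; case: (odd m).
have m0' : 0 < m%:R :> R by rewrite ltr0n.
have p8 := @sqr_pi_ge8 R; have p0 := pi_gt0 R.
have : theta S m.+1 ^+ 2 <= (Num.sqrt 2 / (pi * k%:R) * D) ^+ 2.
  rewrite -real_normK ?num_real// ler_pXn2r ?nnegrE//.
  exact: le_trans h.
move=> /le_trans; apply.
rewrite exprMn ler_wpM2r ?sqr_ge0// expr_div_n sqr_sqrtr// exprMn.
apply: le_trans (_ : 2 / (8 * k%:R ^+ 2) <= _).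
  rewrite ler_wpM2l// lef_pV2 ?posrE ?mulr_gt0 ?exprn_gt0//.
  by rewrite ler_wpM2r// sqr_ge0.
apply: le_trans (_ : (m%:R ^+ 2)^-1 <= _).
  rewrite (_ : 2 / (8 * k%:R ^+ 2) = ((2 * k%:R) ^+ 2)^-1); last first.
    by field; rewrite gt_eqF.
  by rewrite lef_pV2 ?posrE ?exprn_gt0 ?mulr_gt0// ler_pXn2r ?nnegrE ?mulr_ge0 ?(ltW m0') ?(ltW k0).
rewrite (_ : 2 * (m%:R^-1 - m.+1%:R^-1) = 2 / (m%:R * m.+1%:R)); last first.
  by rewrite -natr1; field; rewrite (gt_eqF m0') gt_eqF// addr_gt0.
rewrite -subr_ge0 (_ : _ - _ = (m%:R - 1) / (m%:R ^+ 2 * m.+1%:R)); last first.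
  by rewrite -natr1; field; rewrite (gt_eqF m0') gt_eqF// addr_gt0.
by rewrite divr_ge0 ?mulr_ge0 ?exprn_ge0 ?ler0n// subr_ge0 ler1n.
Qed.

(** With s the integer part of sqrt n, the telescoping sum is at most
    2 |dS|_1^2 / s, and sqrt n < s + 1 <= 2 s. *)
Lemma theta_tail (S dS : R -> R) n : C1_signal S dS -> (L1norm dS < +oo)%E ->
  L2 1 S -> (0 < n)%N ->
  \sum_((Num.truncn (Num.sqrt (n%:R : R))).+1 <= j < n.+1) theta S j ^+ 2
    <= 4 * fine (L1norm dS) ^+ 2 / Num.sqrt n%:R.
Proof.
move=> HC HD LS n0; set D := fine _.
have sn0 : 0 < Num.sqrt n%:R :> R by rewrite sqrtr_gt0 ltr0n.
have s1 : 1 <= Num.sqrt n%:R :> R by rewrite -[leLHS]sqrtr1 ler_wsqrtr// ler1n.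
set s := Num.truncn _.
have /andP[sl su] := truncn_itv (ltW sn0).
have s0 : (0 < s)%N by rewrite truncn_gt0.
have ind N : (s <= N)%N -> \sum_(s.+1 <= j < N.+1) theta S j ^+ 2
    <= 2 * (s%:R^-1 - N%:R^-1) * D ^+ 2.
  elim: N => [|N IH]; first by rewrite leqn0 => /eqP s00; rewrite s00 in s0.
  rewrite leq_eqVlt => /predU1P[->|sN].
    by rewrite big_geq// subrr mulr0 mul0r.
  rewrite big_nat_recr//=.
  have := @theta_sqr_le S dS N HC HD LS (leq_trans s0 sN).
  rewrite -/D => h; apply: le_trans (lerD (IH sN) h) _.
  by rewrite -mulrDl -mulrDr addrA subrK.
have [sn|ns] := leqP s n; last first.
  rewrite big_geq; last by rewrite ltnS ltnW.
  by rewrite divr_ge0 ?(ltW sn0)// mulr_ge0// sqr_ge0.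
apply: le_trans (ind _ sn) _.
rewrite -[leRHS]mulrAC ler_wpM2r ?sqr_ge0//.
have s0' : 0 < s%:R :> R by rewrite ltr0n.
have n0' : 0 <= n%:R^-1 :> R by rewrite invr_ge0.
apply: le_trans (_ : 2 / s%:R <= _); first by lra.
rewrite ler_pdivrMr// mulrAC ler_pdivlMr//.
have : 1 <= s%:R :> R by rewrite ler1n.
by move: su; rewrite -natr1; lra.
Qed.

End Fourier.

(** * The oracle inequality in mean *)

Section OracleExpectation.
Context {d : measure_display} {Om : measurableType d} {R : realType}
  (Q : probability Om R).
Notation Intg f := (Q.-integrable setT (EFin \o f)).

Lemma integrable_prob_cst (c : R) : Intg (fun=> c).
Proof. exact: finite_measure_integrable_cst. Qed.

Lemma Rintegral_prob_cst (c : R) : \int[Q]_w c = c.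
Proof.
rewrite Rintegral_cst// -[RHS]mulr1 -[X in _ = _ * X](_ : fine 1%E = 1)//.
congr (_ * fine _); exact: probability_setT.
Qed.

Variables (r : seq nat) (a vj : nat -> R) (X : nat -> Om -> R) (s : Om -> R).
Variables (T v rho mu l1 l2 sg : R) (G : seq (nat -> R)).
Hypotheses (rho3 : 0 < rho < 3^-1) (v0 : 0 < v) (sg0 : 0 <= sg) (l20 : 0 <= l2).
Hypothesis aT : \sum_(j <- r) a j ^+ 2 <= T.
Hypothesis iX : forall j, Intg (X j).
Hypothesis EX : forall j, \int[Q]_w X j w = 0.
Hypothesis iX2 : forall j, Intg (fun w => X j w ^+ 2).
Hypothesis EX2 : forall j, \int[Q]_w (X j w ^+ 2) = vj j.
Hypothesis iLX : forall c : nat -> R,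
  Intg (fun w => (\sum_(j <- r) c j * X j w) ^+ 2).
Hypothesis ELX : forall c : nat -> R,
  \int[Q]_w ((\sum_(j <- r) c j * X j w) ^+ 2) <= sg * \sum_(j <- r) c j ^+ 2.
Hypothesis ints : Intg s.
Hypothesis G01 : {in G, forall (g : nat -> R) j, 0 <= g j <= 1}.
Hypothesis Gsum : {in G, forall g, \sum_(j <- r) g j <= mu /\ 0 < \sum_(j <- r) g j ^+ 2}.
Hypothesis GL1 : {in G, forall g, `|\sum_(j <- r) g j * (vj j - v)| <= l1 /\
  `|\sum_(j <- r) g j ^+ 2 * (vj j - v)| <= l1}.
Hypothesis iGL2 : {in G, forall g,
  Intg (fun w => (\sum_(j <- r) g j * (X j w ^+ 2 - vj j)) ^+ 2)}.
Hypothesis GL2 : {in G, forall g,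
  \int[Q]_w ((\sum_(j <- r) g j * (X j w ^+ 2 - vj j)) ^+ 2)
    <= l2 * \sum_(j <- r) g j ^+ 2}.

Let x w j := X j w.
Let err g w := loss R r a (x w) T g.
Let crit g w := coord_cost R r a (x w) (s w) rho g.

Lemma integrable_quadratic j (p q c : R) :
  Intg (fun w => p * X j w ^+ 2 + q * X j w + c).
Proof.
apply: integrable_add => //; last exact: integrable_prob_cst.
by apply: integrable_add => //; exact: integrableZ.
Qed.

Lemma Rintegral_quadratic j (p q c : R) :
  \int[Q]_w (p * X j w ^+ 2 + q * X j w + c) = p * vj j + c.
Proof.
have i1 : Intg (fun w => p * X j w ^+ 2) by exact: integrableZ.
have i2 : Intg (fun w => q * X j w) by exact: integrableZ.
rewrite RintegralD//; [|exact: integrable_add|exact: integrable_prob_cst].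
rewrite RintegralD// !RintegralZl// EX mulr0 addr0 Rintegral_prob_cst.
by rewrite EX2.
Qed.

Lemma err_quadratic g w : err g w =
  \sum_(j <- r) (g j ^+ 2 * X j w ^+ 2 + 2 * g j * (g j - 1) * a j * X j w
    + (g j ^+ 2 - 2 * g j) * a j ^+ 2) + T.
Proof.
rewrite /err /loss mulr_sumr -sumrB; congr (_ + _).
by apply: eq_bigr => j _; rewrite /x; ring.
Qed.

Lemma integrable_err g : Intg (err g).
Proof.
have -> : err g = (fun w => \sum_(j <- r) (g j ^+ 2 * X j w ^+ 2
    + 2 * g j * (g j - 1) * a j * X j w + (g j ^+ 2 - 2 * g j) * a j ^+ 2) + T).
  by apply/funext => w; exact: err_quadratic.
apply: integrable_add => //; last exact: integrable_prob_cst.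
by apply: integrable_bigsum => // j; exact: integrable_quadratic.
Qed.

(** The mean of (g (a + X) - a)^2 is (g - 1)^2 a^2 + g^2 vj: the loss of a
    linear estimator is at least its variance. *)
Lemma variance_le_loss g : g \in G ->
  v * \sum_(j <- r) g j ^+ 2 <= \int[Q]_w err g w + l1.
Proof.
move=> gG; have [_ B] := GL1 _ gG.
have E : \int[Q]_w (\sum_(j <- r) (g j ^+ 2 * X j w ^+ 2
    + 2 * (g j - 1) * g j * a j * X j w + (g j - 1) ^+ 2 * a j ^+ 2)) =
    \sum_(j <- r) (g j ^+ 2 * vj j + (g j - 1) ^+ 2 * a j ^+ 2).
  rewrite Rintegral_bigsum//; last by move=> j; exact: integrable_quadratic.
  by apply: eq_bigr => j _; rewrite Rintegral_quadratic.
have le : \sum_(j <- r) (g j ^+ 2 * vj j + (g j - 1) ^+ 2 * a j ^+ 2)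
    <= \int[Q]_w err g w.
  rewrite -E; apply: le_Rintegral => //; last 1 first.
  - move=> w _; apply: le_trans (loss_ge_sum_sqr R r a (x w) T g aT).
    rewrite le_eqVlt; apply/orP; left; apply/eqP.
    by apply: eq_bigr => j _; rewrite /x; ring.
  - by apply: integrable_bigsum => // j; exact: integrable_quadratic.
  - exact: integrable_err.
have : \sum_(j <- r) g j ^+ 2 * vj j <=
    \sum_(j <- r) (g j ^+ 2 * vj j + (g j - 1) ^+ 2 * a j ^+ 2).
  by apply: ler_sum => j _; rewrite lerDl mulr_ge0 ?sqr_ge0.
have -> : v * \sum_(j <- r) g j ^+ 2 = \sum_(j <- r) g j ^+ 2 * vj j
    - \sum_(j <- r) g j ^+ 2 * (vj j - v).
  by rewrite mulr_sumr -sumrB; apply: eq_bigr => j _; ring.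
by move: B; rewrite ler_norml => /andP[B _]; lra.
Qed.

(** The denominator is, up to sg, a bound on the second moment of the linear
    noise, so the mean is bounded uniformly in y. *)
Lemma lin_ratio_expectation (y : nat -> R) :
  Intg (fun w => lin_ratio R r a (x w) y) /\
  \int[Q]_w lin_ratio R r a (x w) y <= sg.
Proof.
have E w : lin_ratio R r a (x w) y = (\sum_(j <- r) y j ^+ 2 * a j ^+ 2)^-1 *
    (\sum_(j <- r) (y j * a j) * X j w) ^+ 2 by rewrite mulrC.
split.
  under eq_fun do rewrite E.
  by apply: integrableZ => //; exact: iLX.
under eq_Rintegral do rewrite E.
rewrite RintegralZl//.
apply: le_trans (ler_wpM2l _ (ELX _)) _.
  by rewrite invr_ge0 sumr_ge0// => j _; rewrite mulr_ge0 ?sqr_ge0.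
have -> : \sum_(j <- r) (y j * a j) ^+ 2 = \sum_(j <- r) y j ^+ 2 * a j ^+ 2.
  by apply: eq_bigr => j _; rewrite exprMn.
rewrite mulrCA; set D := \sum_(j <- r) _.
by have [->|D0] := eqVneq D 0; rewrite ?invr0 ?mulr0// mulVf// mulr1.
Qed.

(** As y^4 <= y^2, the weights y^2 have a second moment no larger than the
    weights y. *)
Lemma quad_ratio_expectation (y : nat -> R) : (forall j, `|y j| <= 1) ->
  Intg (fun w => quad_ratio R r a (x w) y) /\
  \int[Q]_w quad_ratio R r a (x w) y <= sg.
Proof.
move=> y1.
have E w : quad_ratio R r a (x w) y = (\sum_(j <- r) y j ^+ 2 * a j ^+ 2)^-1 *
    (\sum_(j <- r) (y j ^+ 2 * a j) * X j w) ^+ 2 by rewrite mulrC.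
split.
  under eq_fun do rewrite E.
  by apply: integrableZ => //; exact: iLX.
under eq_Rintegral do rewrite E.
rewrite RintegralZl//.
have D0 : 0 <= \sum_(j <- r) y j ^+ 2 * a j ^+ 2.
  by rewrite sumr_ge0// => j _; rewrite mulr_ge0 ?sqr_ge0.
apply: le_trans (ler_wpM2l _ (ELX _)) _; first by rewrite invr_ge0.
have le : \sum_(j <- r) (y j ^+ 2 * a j) ^+ 2 <= \sum_(j <- r) y j ^+ 2 * a j ^+ 2.
  apply: ler_sum => j _; rewrite exprMn ler_wpM2r ?sqr_ge0//.
  rewrite -exprM -[2%N]addn1 mulnDl mul1n exprD ler_piMl ?sqr_ge0//.
  by rewrite -real_normK ?num_real// expr_le1.
rewrite mulrCA; move: D0 le; set D := \sum_(j <- r) y j ^+ 2 * _ => D0 le.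
rewrite -[leRHS]mulr1 ler_wpM2l//.
have [D00|D00] := eqVneq D 0; first by rewrite D00 invr0 mul0r.
by rewrite mulrC ler_pdivrMr ?mul1r// lt_neqAle eq_sym D00.
Qed.

Lemma noise_ratio_expectation g : g \in G ->
  Intg (fun w => noise_ratio R r (x w) vj v g) /\
  \int[Q]_w noise_ratio R r (x w) vj v g <= l2 / v.
Proof.
move=> gG; have [_ q0] := Gsum _ gG.
have E w : noise_ratio R r (x w) vj v g = (v * \sum_(j <- r) g j ^+ 2)^-1 *
    (\sum_(j <- r) g j * (X j w ^+ 2 - vj j)) ^+ 2 by rewrite mulrC.
split.
  under eq_fun do rewrite E.
  by apply: integrableZ => //; exact: iGL2.
under eq_Rintegral do rewrite E.
rewrite RintegralZl//; last exact: iGL2.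
apply: le_trans (ler_wpM2l _ (GL2 _ gG)) _.
  by rewrite invr_ge0 mulr_ge0 ?ltW.
rewrite le_eqVlt; apply/orP; left; apply/eqP.
by field; rewrite (gt_eqF v0) gt_eqF.
Qed.

(** The majorant M does not depend on the selected weight g: the ratios of
    pointwise_oracle are replaced by their sums over G.  It is therefore
    measurable even if the selection is not. *)
Lemma oracle_expectation g0 : g0 \in G ->
  exists M : Om -> R, [/\ Intg M,
    forall w g, g \in G -> crit g w <= crit g0 w -> err g w <= M w &
    \int[Q]_w M w <=
      (1 + 3 * rho - 2 * rho ^+ 2) / (1 - 3 * rho) * \int[Q]_w err g0 w
      + (2 * (size G)%:R * sg / rho + 2 * (size G)%:R * (l2 / v) / rho
         + (4 + 2 * rho) * l1 + 2 * mu * \int[Q]_w `|s w - v|) / (1 - 3 * rho)].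
Proof.
move=> g0G; have r0 : 0 < rho by case/andP: rho3.
have r3 : 0 < 1 - 3 * rho by have /andP[_ ?] := rho3; lra.
pose y g j := g j - g0 j : R.
have y1 g : g \in G -> forall j, `|y g j| <= 1.
  move=> gG j; have /andP[? ?] := G01 _ gG j; have /andP[? ?] := G01 _ g0G j.
  by rewrite ler_norml /y; apply/andP; split; lra.
(* The noise ratio is counted twice, once for the selected weight and once for
   g0; the value 0 outside G makes the bounds hold for all indices of the sum. *)
pose U g w := if g \in G then lin_ratio R r a (x w) (y g)
  + quad_ratio R r a (x w) (y g) + 2 * noise_ratio R r (x w) vj v g else 0.
have linge0 w z : 0 <= lin_ratio R r a (x w) z.
  by rewrite divr_ge0 ?sqr_ge0// sumr_ge0// => j _; rewrite mulr_ge0 ?sqr_ge0.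
have quadge0 w z : 0 <= quad_ratio R r a (x w) z.
  by rewrite divr_ge0 ?sqr_ge0// sumr_ge0// => j _; rewrite mulr_ge0 ?sqr_ge0.
have chige0 w z : 0 <= noise_ratio R r (x w) vj v z.
  by rewrite divr_ge0 ?sqr_ge0// mulr_ge0 ?(ltW v0)// sumr_ge0// => j _; rewrite sqr_ge0.
have iU g : Intg (U g) /\ \int[Q]_w U g w <= 2 * sg + 2 * (l2 / v).
  rewrite /U; case: (boolP (g \in G)) => gG; last first.
    split; first exact: integrable_prob_cst.
    by rewrite Rintegral_prob_cst addr_ge0// mulr_ge0// divr_ge0// ltW.
  have [i1 e1] := lin_ratio_expectation (y g).
  have [i2 e2] := quad_ratio_expectation (y g) (y1 g gG).
  have [i3 e3] := noise_ratio_expectation g gG.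
  have i12 := integrable_add measurableT _ _ i1 i2.
  have i4 : Intg (fun w => 2 * noise_ratio R r (x w) vj v g) by exact: integrableZ.
  split; first exact: integrable_add.
  by rewrite RintegralD// RintegralD// RintegralZl//; lra.
pose A w := \sum_(g <- G) U g w.
have iA : Intg A by apply: integrable_bigsum => // g; exact: (iU g).1.
have EA : \int[Q]_w A w <= (size G)%:R * (2 * sg + 2 * (l2 / v)).
  rewrite Rintegral_bigsum//; last by move=> g; exact: (iU g).1.
  apply: le_trans (_ : \sum_(g <- G) (2 * sg + 2 * (l2 / v)) <= _).
    by apply: ler_sum => g _; exact: (iU g).2.
  by rewrite big_const_seq count_predT iter_addr addr0 (mulr_natl _ (size G)).
pose S2 := \sum_(j <- r) g0 j ^+ 2.
have iabs : Intg (fun w => `|s w - v|).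
  have : Intg (fun w => s w - v) by apply: integrable_sub => //; exact: integrable_prob_cst.
  exact: integrable_abse.
pose kap := 2 * rho * (1 - rho) * (v * S2) + 4 * l1.
pose M w := (1 - 3 * rho)^-1 * ((1 + rho) * err g0 w + rho^-1 * A w
  + (2 * mu) * `|s w - v| + kap).
have ie : Intg (fun w => (1 + rho) * err g0 w).
  by apply: integrableZ => //; exact: integrable_err.
have iA' : Intg (fun w => rho^-1 * A w) by exact: integrableZ.
have ia' : Intg (fun w => (2 * mu) * `|s w - v|) by exact: integrableZ.
have i1 : Intg (fun w => (1 + rho) * err g0 w + rho^-1 * A w) by exact: integrable_add.
have i2 : Intg (fun w => (1 + rho) * err g0 w + rho^-1 * A w
   + (2 * mu) * `|s w - v|) by exact: integrable_add.
have i3 : Intg (fun w => (1 + rho) * err g0 w + rho^-1 * A w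
   + (2 * mu) * `|s w - v| + kap).
  by apply: integrable_add => //; exact: integrable_prob_cst.
exists M; split.
- exact: integrableZ.
- move=> w g gG cg; rewrite /M mulrC ler_pdivlMr// mulrC.
  have H f : f = g \/ f = g0 -> [/\ 0 <= \sum_(j <- r) f j <= mu,
     0 < \sum_(j <- r) f j ^+ 2 <= mu & `|\sum_(j <- r) f j * (vj j - v)| <= l1].
    move=> fE; have fG : f \in G by case: fE => ->.
    have [m1 m2] := Gsum _ fG; have [m3 _] := GL1 _ fG; split => //.
      by rewrite m1 andbT sumr_ge0// => j _; case/andP: (G01 _ fG j).
    rewrite m2 /=; apply: le_trans m1; apply: ler_sum => j _.
    by have /andP[? ?] := G01 _ fG j; rewrite expr2 ler_piMl.
  have := pointwise_oracle R r a (x w) vj T (s w) v rho mu l1 g g0 rho3 v0 aT H cg.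
  have : lin_ratio R r a (x w) (y g) + quad_ratio R r a (x w) (y g)
       + noise_ratio R r (x w) vj v g + noise_ratio R r (x w) vj v g0 <= A w.
    pose U1 f := if f \in G then lin_ratio R r a (x w) (y f)
      + quad_ratio R r a (x w) (y f) + noise_ratio R r (x w) vj v f else 0.
    pose U2 f := if f \in G then noise_ratio R r (x w) vj v f else 0.
    have -> : A w = \sum_(f <- G) U1 f + \sum_(f <- G) U2 f.
      rewrite -big_split; apply: eq_bigr => f _; rewrite /U /U1 /U2 /=.
      by case: ifP => _; [ring|rewrite addr0].
    have h1 : U1 g <= \sum_(f <- G) U1 f.
      rewrite (big_rem g)//= lerDl sumr_ge0// => f _; rewrite /U1.
      by case: ifP => // _; rewrite !addr_ge0.
    have h2 : U2 g0 <= \sum_(f <- G) U2 f.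
      rewrite (big_rem g0)//= lerDl sumr_ge0// => f _; rewrite /U2.
      by case: ifP.
    by move: (lerD h1 h2); rewrite /U1 /U2 gG g0G.
  move=> hA; rewrite -/S2 -/(err g w) -/(err g0 w).
  have : rho^-1 * (lin_ratio R r a (x w) (y g) + quad_ratio R r a (x w) (y g)
       + noise_ratio R r (x w) vj v g + noise_ratio R r (x w) vj v g0) <= rho^-1 * A w.
    by rewrite ler_pM2l// invr_gt0.
  rewrite (mulrC (rho^-1) (_ + _)) /kap -/(y g).
  by lra.
- rewrite /M RintegralZl// RintegralD//; last exact: integrable_prob_cst.
  rewrite RintegralD// RintegralD// !RintegralZl//; last exact: integrable_err.
  rewrite Rintegral_prob_cst.
  have nl := variance_le_loss g0 g0G; rewrite -/S2 in nl.
  rewrite [X in _ <= X + _]mulrAC -mulrDl mulrC ler_pM2r ?invr_gt0//.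
  have h1 : rho^-1 * \int[Q]_w A w <= rho^-1 * ((size G)%:R * (2 * sg + 2 * (l2 / v))).
    by rewrite ler_pM2l// invr_gt0.
  have h2 : 2 * rho * (1 - rho) * (v * S2) <= 2 * rho * (1 - rho) * (\int[Q]_w err g0 w + l1).
    by rewrite ler_wpM2l// !mulr_ge0//; lra.
  have [m3 _] := GL1 _ g0G; have l10 : 0 <= l1 by exact: le_trans m3.
  have h3 : 0 <= rho * rho * l1 by rewrite !mulr_ge0// ltW.
  rewrite /kap; move: h1 h2; lra.
Qed.

End OracleExpectation.

(** * Finitely supported sequences and second moments *)

Section FiniteSums.
Context {R : realType}.
Implicit Types (x F : nat -> R) (r : seq nat).

Lemma fsum_pos_idx r F : uniq r -> {in r, forall j, 0 < j}%N ->
  (forall j, (0 < j)%N -> j \notin r -> F j = 0) ->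
  \sum_(j \in pos_idx) F j = \sum_(j <- r) F j.
Proof.
move=> ur r0 F0; rewrite [RHS]fsbig_seq//; symmetry; apply: fsbig_widen.
  by move=> j /= jr; exact: r0.
by move=> j [j0 jr]; apply: F0 => //; exact/negP.
Qed.

Lemma supp_card_le r x (n : nat) : (forall j, (0 < j)%N -> x j != 0 -> j \in r) ->
  (size r <= n)%N -> (supp x #<= `I_n)%card.
Proof.
move=> xr rn; apply: (@card_le_trans _ _ _ [set` r]).
  apply: subset_card_le => j /= [j0]; rewrite normr_gt0; exact: xr.
apply: (@card_le_trans _ _ _ `I_(size r)); last by rewrite card_le_II.
have -> : [set` r] = nth 0%N r @` `I_(size r).
  apply/seteqP; split => j /=.
    by move=> jr; exists (index j r); rewrite /= ?index_mem ?nth_index.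
  by move=> [i /= ir <-]; exact: mem_nth.
exact: card_image_le.
Qed.

End FiniteSums.

Section MeanAbs.
Context {d : measure_display} {Om : measurableType d} {R : realType}
  (Q : probability Om R).
Notation Intg f := (Q.-integrable setT (EFin \o f)).

(** |f| <= 1 + f^2. *)
Lemma integrable_of_sqr (f : Om -> R) : measurable_fun setT f ->
  Intg (fun w => f w ^+ 2) -> Intg f.
Proof.
move=> mf if2.
have : Intg (fun w => 1 + f w ^+ 2).
  by apply: integrable_add => //; exact: integrable_prob_cst.
apply: le_integrable => //; first exact/measurable_EFinP.
move=> w _ /=; rewrite lee_fin [leRHS]ger0_norm ?addr_ge0 ?sqr_ge0//.
rewrite -[f w ^+ 2]real_normK ?num_real//.
have := sqr_ge0 (`|f w| - 1); have : 0 <= `|f w| by []; rewrite sqrrB1.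
have := sqr_ge0 `|f w|.
lra.
Qed.

Lemma integrable_ge0 (f : Om -> R) (c : \bar R) : measurable_fun setT f ->
  (forall w, 0 <= f w) -> (\int[Q]_w (f w)%:E <= c)%E -> (c < +oo)%E -> Intg f.
Proof.
move=> mf f0 fc cy; apply/integrableP; split; first exact/measurable_EFinP.
apply: le_lt_trans cy; apply: le_trans fc; rewrite le_eqVlt; apply/orP; left.
by apply/eqP; apply: eq_integral => w _ /=; rewrite ger0_norm.
Qed.

Lemma Rintegral_EFin (f : Om -> R) : Intg f ->
  (\int[Q]_w (f w)%:E = (\int[Q]_w f w)%:E)%E.
Proof. by move=> i; rewrite /Rintegral fineK//; exact: integrable_fin_num. Qed.

(** |f| <= c / 2 + f^2 / (2 c) for every c > b; letting c tend to b rather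
    than taking c = b covers the case b = 0. *)
Lemma mean_abs_le (f : Om -> R) (b : R) : measurable_fun setT f ->
  Intg (fun w => f w ^+ 2) -> 0 <= b -> \int[Q]_w (f w ^+ 2) <= b ^+ 2 ->
  \int[Q]_w `|f w| <= b.
Proof.
move=> mf if2 b0 fb; apply/ler_addgt0Pr => e e0.
have be : 0 < b + e by rewrite ltr_wpDl.
have i1 : Intg (fun w => (2 * (b + e))^-1 * f w ^+ 2) by exact: integrableZ.
apply: le_trans (_ : \int[Q]_w ((b + e) / 2 + (2 * (b + e))^-1 * f w ^+ 2) <= _).
  apply: le_Rintegral => //.
  - exact: (integrable_abse (integrable_of_sqr _ mf if2)).
  - by apply: integrable_add => //; exact: integrable_prob_cst.
  - move=> w _; rewrite -[f w ^+ 2]real_normK ?num_real// -subr_ge0.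
    rewrite (_ : _ - _ = (`|f w| - (b + e)) ^+ 2 / (2 * (b + e))).
      by rewrite divr_ge0 ?sqr_ge0// mulr_ge0// ltW.
    by field; rewrite gt_eqF.
rewrite RintegralD//; last exact: integrable_prob_cst.
rewrite Rintegral_prob_cst RintegralZl//.
have : (2 * (b + e))^-1 * (\int[Q]_w (f w ^+ 2)) <= (2 * (b + e))^-1 * (b + e) ^+ 2.
  rewrite ler_pM2l ?invr_gt0 ?mulr_gt0//; apply: le_trans fb _.
  by rewrite ler_pXn2r ?nnegrE// ?(ltW be)// lerDl ltW.
rewrite (_ : (2 * (b + e))^-1 * (b + e) ^+ 2 = (b + e) / 2).
  lra.
by field; rewrite gt_eqF.
Qed.

End MeanAbs.

(** * Moments of the noise *)

Section Noise.
Context {R : realType} {n : nat} (Q : probability (D_space (n%:R : R)) R)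
  (I : (R -> R) -> D_space (n%:R : R) -> R) (sg vs L : R).
Notation Intg f := (Q.-integrable setT (EFin \o f)).
Notation leb := (@lebesgue_measure R).
Hypotheses (n0 : (0 < n)%N) (HN : noise_law Q sg I) (vs0 : 0 < vs).
Hypothesis HL : (L1n Q I vs + L2n Q I <= L%:E)%E.
Implicit Types (c x : nat -> R) (r : seq nat).

Lemma measurable_noise f : L2 n%:R f -> measurable_fun setT (I f).
Proof. by case: HN => _ _ [h _ _ _ _]; exact: h. Qed.

(** Linearity of the integral holds almost surely for each combination of two
    functions, hence for a finite sum on a finite intersection of almost sure
    events. *)
Lemma noise_linear_ae r c :
  {ae Q, forall w, I (fun t => \sum_(j <- r) c j * phi j t) w
                 = \sum_(j <- r) c j * I (phi j) w}.
Proof.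
case: HN => _ _ [_ lin _ _ _].
elim: r => [|j r IH].
  have := lin 0 0 (phi 0) (phi 0) (phi_L2 _ _) (phi_L2 _ _).
  apply: filterS => w; rewrite big_nil !mul0r addr0 => h; rewrite -[RHS]h.
  by congr (I _ _); apply/funext => t; rewrite big_nil !mul0r addr0.
have := lin (c j) 1 _ _ (phi_L2 _ j) (continuous_L2 _ _ (continuous_trig r c)).
move: IH; apply: filterS2 => w IH; rewrite big_cons -IH mul1r => h; rewrite -[RHS]h.
by congr (I _ _); apply/funext => t; rewrite big_cons mul1r.
Qed.

Lemma noise_sqr f : L2 n%:R f -> Intg (fun w => I f w ^+ 2) /\
  \int[Q]_w (I f w ^+ 2) <= sg * \int[leb]_(t in `[0, n%:R]) (f t ^+ 2).
Proof.
move=> Lf; case: HN => _ sg0 [_ _ _ _ /(_ f Lf)].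
rewrite L2_sqr// -EFinM unlock => h.
have i2 : Intg (fun w => I f w ^+ 2).
  apply: (integrable_ge0 _ _ _ _ _ h); last exact: ltry.
    by apply: measurable_funX; exact: measurable_noise.
  by move=> w; exact: sqr_ge0.
by split => //; move: h; rewrite Rintegral_EFin// lee_fin.
Qed.

Lemma noise_mean f : L2 n%:R f -> Intg (I f) /\ \int[Q]_w I f w = 0.
Proof.
move=> Lf; have [i2 _] := noise_sqr f Lf.
have i1 : Intg (I f) by apply: integrable_of_sqr => //; exact: measurable_noise.
split => //; case: HN => _ _ [_ _ _ /(_ f Lf) + _].
by rewrite unlock Rintegral_EFin// => -[].
Qed.

Lemma noise_comb_sqr r c : uniq r -> {in r, forall j, 0 < j}%N ->
  Intg (fun w => (\sum_(j <- r) c j * I (phi j) w) ^+ 2) /\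
  \int[Q]_w ((\sum_(j <- r) c j * I (phi j) w) ^+ 2)
    <= sg * n%:R * \sum_(j <- r) c j ^+ 2.
Proof.
move=> ur r0; pose f t := \sum_(j <- r) c j * phi j t : R.
have Lf : L2 n%:R f by apply: continuous_L2; exact: continuous_trig.
have [i2] := noise_sqr f Lf.
rewrite integral_trig_sqr_period// mulrA.
have mS : measurable_fun setT (fun w => (\sum_(j <- r) c j * I (phi j) w) ^+ 2).
  apply: measurable_funX; apply: measurable_sum => j.
  apply: measurable_funM; first exact: measurable_cst.
  by apply: measurable_noise; exact: phi_L2.
have mf : measurable_fun setT (fun w => I f w ^+ 2).
  by apply: measurable_funX; exact: measurable_noise.
have E : (\int[Q]_w ((\sum_(j <- r) c j * I (phi j) w) ^+ 2)%:E
        = \int[Q]_w (I f w ^+ 2)%:E)%E.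
  apply: ae_eq_integral => //; [exact/measurable_EFinP|exact/measurable_EFinP|].
  by have := noise_linear_ae r c; apply: filterS => w h _; rewrite /= -h.
have iS : Intg (fun w => (\sum_(j <- r) c j * I (phi j) w) ^+ 2).
  apply: (integrable_ge0 _ _ (\int[Q]_w (I f w ^+ 2)%:E)) => //.
  - by move=> w; exact: sqr_ge0.
  - by rewrite E.
  - by rewrite Rintegral_EFin// ltry.
by rewrite /Rintegral E; split.
Qed.

Lemma integrable_xi2 j : Intg (fun w => xi I j w ^+ 2).
Proof.
have [i2 _] := noise_sqr _ (phi_L2 n%:R j).
have -> : (fun w => xi I j w ^+ 2) = (fun w => n%:R^-1 * I (phi j) w ^+ 2).
  by apply/funext => w; rewrite /xi expr_div_n sqr_sqrtr ?ler0n// mulrC.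
exact: integrableZ.
Qed.

Lemma Exi2E j : Exi2 Q I j = \int[Q]_w (xi I j w ^+ 2).
Proof. by rewrite /Exi2 unlock. Qed.

(** Both suprema are nonnegative, as x = 0 shows for this one, so the bound
    on their sum bounds each of them. *)
Lemma L1n_ge0 : (0 <= L1n Q I vs)%E.
Proof.
apply: ereal_sup_ubound; exists (fun=> 0).
  split; first by move=> j; rewrite lerN10 ler01.
  by apply: (supp_card_le [::]) => // j _; rewrite eqxx.
rewrite (fsum_pos_idx [::]) ?big_nil ?normr0// => j _ _.
by rewrite mul0r.
Qed.

Lemma L2n_ge0 : (0 <= L2n Q I)%E.
Proof.
apply: le_trans (_ : 'E_Q[fun w => ((\sum_(j \in pos_idx) (fun=> 0) j *
   (xi I j w ^+ 2 - Exi2 Q I j)) ^+ 2)%R] <= _)%E.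
  by rewrite unlock; apply: integral_ge0 => w _; rewrite lee_fin sqr_ge0.
apply: ereal_sup_ubound; exists (fun=> 0) => //; split.
  by apply: (supp_card_le [::]) => // j _; rewrite eqxx.
rewrite /sqnorm (fsum_pos_idx [::]) ?big_nil ?sqrtr0 ?ler01// => j _ _.
by rewrite expr0n.
Qed.

Lemma noise_L1 r x : uniq r -> {in r, forall j, 0 < j}%N ->
  {in r, forall j, `|x j| <= 1} -> (count (fun j => x j != 0%R) r <= n)%N ->
  `|\sum_(j <- r) x j * (Exi2 Q I j - vs)| <= L.
Proof.
move=> ur r0 x1 cn; pose x' j := if j \in r then x j else 0.
rewrite -lee_fin; apply: le_trans HL.
apply: le_trans (_ : _ <= L1n Q I vs)%E _; last by rewrite leeDl// L2n_ge0.
apply: ereal_sup_ubound; exists x'.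
  split.
    move=> j; rewrite /x'; case: ifP => [/x1|_]; last by rewrite lerN10 ler01.
    by rewrite ler_norml.
  apply: (supp_card_le [seq j <- r | x j != 0%R]); last by rewrite size_filter.
  move=> j j0; rewrite /x' mem_filter; case: ifP => //; last by rewrite eqxx.
  by move=> _ ->.
congr (`|_|%:E); rewrite (fsum_pos_idx r)//.
  by rewrite big_seq [RHS]big_seq; apply: eq_bigr => j jr; rewrite /x' jr.
by move=> j _ jr; rewrite /x' (negbTE jr) mul0r.
Qed.

(** The supremum defining L2n runs over the unit ball, so x is divided by its
    norm. *)
Lemma noise_L2 r x : uniq r -> {in r, forall j, 0 < j}%N ->
  (count (fun j => x j != 0%R) r <= n)%N ->
  Intg (fun w => (\sum_(j <- r) x j * (xi I j w ^+ 2 - Exi2 Q I j)) ^+ 2) /\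
  \int[Q]_w ((\sum_(j <- r) x j * (xi I j w ^+ 2 - Exi2 Q I j)) ^+ 2)
    <= L * \sum_(j <- r) x j ^+ 2.
Proof.
move=> ur r0 cn; set q := \sum_(j <- r) x j ^+ 2.
have q0 : 0 <= q by apply: sumr_ge0 => j _; exact: sqr_ge0.
have [qe|qn] := eqVneq q 0.
  have z w : (\sum_(j <- r) x j * (xi I j w ^+ 2 - Exi2 Q I j)) ^+ 2 = 0.
    by rewrite weighted_sum0// expr0n.
  rewrite qe mulr0; split.
    under eq_fun do rewrite z; exact: integrable_prob_cst.
  by under eq_Rintegral do rewrite z; rewrite Rintegral_prob_cst.
have qp : 0 < q by rewrite lt_neqAle eq_sym qn.
pose S w := \sum_(j <- r) x j * (xi I j w ^+ 2 - Exi2 Q I j).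
have mS : measurable_fun setT (fun w => S w ^+ 2).
  apply: measurable_funX; apply: measurable_sum => j.
  apply: measurable_funM; first exact: measurable_cst.
  apply: measurable_funB; last exact: measurable_cst.
  by have /integrableP[/measurable_EFinP] := integrable_xi2 j.
pose x' j := if j \in r then x j / Num.sqrt q else 0.
have E w : (\sum_(j \in pos_idx) x' j * (xi I j w ^+ 2 - Exi2 Q I j)) ^+ 2
    = q^-1 * S w ^+ 2.
  rewrite (fsum_pos_idx r)//; last by move=> j _ jr; rewrite /x' (negbTE jr) mul0r.
  transitivity ((Num.sqrt q)^-1 ^+ 2 * S w ^+ 2).
    rewrite -exprMn; congr (_ ^+ 2); rewrite mulr_sumr big_seq [RHS]big_seq.
    by apply: eq_bigr => j jr; rewrite /x' jr mulrAC mulrC.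
  by rewrite exprVn sqr_sqrtr.
have h : (\int[Q]_w (q^-1 * S w ^+ 2)%:E <= L%:E)%E.
  apply: le_trans HL; apply: le_trans (_ : _ <= L2n Q I)%E _; last first.
    by rewrite leeDr// L1n_ge0.
  apply: ereal_sup_ubound; exists x'; last first.
    by rewrite unlock; apply: eq_integral => w _; rewrite E.
  split.
    apply: (supp_card_le [seq j <- r | x j != 0%R]); last by rewrite size_filter.
    move=> j j0; rewrite /x' mem_filter; case: ifP => //; last by rewrite eqxx.
    by move=> _ h; rewrite andbT; apply: contra h => /eqP ->; rewrite mul0r.
  rewrite /sqnorm (fsum_pos_idx r)//; last first.
    by move=> j _ jr; rewrite /x' (negbTE jr) expr0n.
  rewrite (_ : \sum_(j <- r) x' j ^+ 2 = 1) ?sqrtr1//.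
  transitivity (q^-1 * q); last by rewrite mulVf.
  rewrite mulr_sumr big_seq [RHS]big_seq; apply: eq_bigr => j jr.
  by rewrite /x' jr expr_div_n sqr_sqrtr// mulrC.
have i0 : Intg (fun w => q^-1 * S w ^+ 2).
  apply: (integrable_ge0 _ _ _ _ _ h); last exact: ltry.
    by apply: measurable_funM => //; exact: measurable_cst.
  by move=> w; rewrite mulr_ge0 ?sqr_ge0// invr_ge0.
have iS : Intg (fun w => S w ^+ 2).
  have -> : (fun w => S w ^+ 2) = (fun w => q * (q^-1 * S w ^+ 2)).
    by apply/funext => w; rewrite mulrA mulfV// mul1r.
  exact: integrableZ.
split => //; move: h; rewrite Rintegral_EFin// lee_fin RintegralZl//.
by rewrite mulrC ler_pdivrMr.
Qed.

End Noise.

(** * The variance estimator *)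

Section SigmaHat.
Context {R : realType} {n : nat} (Q : probability (D_space (n%:R : R)) R)
  (I : (R -> R) -> D_space (n%:R : R) -> R) (sg vs L : R) (S dS : R -> R).
Notation Intg f := (Q.-integrable setT (EFin \o f)).
Notation leb := (@lebesgue_measure R).
Hypotheses (n0 : (0 < n)%N) (HN : noise_law Q sg I) (vs0 : 0 < vs).
Hypothesis HL : (L1n Q I vs + L2n Q I <= L%:E)%E.
Hypothesis SP : forall t, S (t + 1) = S t.
Hypothesis LS : L2 1 S.

Lemma theta_hat_observed w j :
  theta_hat n (observed S I w) j = theta S j + I (phi j) w / n%:R.
Proof.
rewrite /theta_hat /observed integral_phi_signal// mulrDl mulrC mulKf//.
by rewrite pnatr_eq0 -lt0n.
Qed.

Lemma integrable_theta_hat2 j : Intg (fun w => theta_hat n (observed S I w) j ^+ 2).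
Proof.
have Lp := phi_L2 (n%:R : R) j.
have [i2 _] := noise_sqr Q I _ HN _ Lp; have [i1 _] := noise_mean Q I _ HN _ Lp.
have -> : (fun w => theta_hat n (observed S I w) j ^+ 2) =
  (fun w => theta S j ^+ 2 + (2 * theta S j / n%:R) * I (phi j) w
    + n%:R^-1 ^+ 2 * I (phi j) w ^+ 2).
  by apply/funext => w; rewrite theta_hat_observed; ring.
apply: integrable_add => //; last exact: integrableZ.
by apply: integrable_add => //; [exact: integrable_prob_cst|exact: integrableZ].
Qed.

Lemma integrable_sigma_hat : Intg (fun w => sigma_hat n (observed S I w)).
Proof. by apply: integrable_bigsum => // j; exact: integrable_theta_hat2. Qed.

Lemma sqr_root4 : ((n%:R : R) `^ 4^-1) ^+ 2 = Num.sqrt n%:R.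
Proof.
rewrite -powR_mulrn ?powR_ge0// -powRrM -powR12_sqrt ?ler0n//.
by congr (_ `^ _); field.
Qed.

Hypotheses (HC : C1_signal S dS) (HD : (L1norm dS < +oo)%E).

(** The estimator minus vs is the sum of the energy of the signal at the
    indices s < j <= n, where s = [sqrt n], its product with the noise, the
    centred squares of the noise, their bias, and - vs s / n, because the sum
    has n - s terms and is divided by n.  Each of them is at most of order
    n^(-1/2) in mean. *)
Lemma sigma_hat_error :
  \int[Q]_w `|sigma_hat n (observed S I w) - vs| <=
  (4 * fine (L1norm dS) ^+ 2 + vs + Num.sqrt L
   + 4 * fine (L1norm dS) * Num.sqrt sg / n%:R `^ 4^-1 + L / Num.sqrt n%:R)
  / Num.sqrt n%:R.
Proof.
have tail := @theta_tail R S dS n HC HD LS n0.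
have D0 := L1norm_ge0 dS; move: tail D0; set D := fine _; set rn := Num.sqrt n%:R.
set s := Num.truncn _ => tail D0.
pose r := index_iota s.+1 n.+1; pose q := (n%:R : R) `^ 4^-1.
have ur : uniq r by exact: iota_uniq.
have r0 : {in r, forall j, 0 < j}%N.
  by move=> j; rewrite mem_index_iota => /andP[/(leq_ltn_trans (leq0n _))].
have n0' : 0 < n%:R :> R by rewrite ltr0n.
have rn0 : 0 < rn by rewrite sqrtr_gt0.
have rn2 : rn ^+ 2 = n%:R by rewrite sqr_sqrtr ?ler0n.
have q0 : 0 < q by rewrite powR_gt0.
have q2 : q ^+ 2 = rn by exact: sqr_root4.
have sg0 : 0 < sg by case: HN.
have sr : s%:R <= rn by rewrite truncn_le// ltW.
have sn : (s <= n)%N.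
  rewrite -(ler_nat R); apply: le_trans sr _; rewrite -rn2 expr2 ler_peMl// ?(ltW rn0)//.
  by rewrite -[leLHS]sqrtr1 ler_wsqrtr// ler1n.
have szr : size r = (n - s)%N by rewrite size_iota subSS.
have cr (x : nat -> R) : (count (fun j => x j != 0%R) r <= n)%N.
  by apply: leq_trans (count_size _ _) _; rewrite szr leq_subr.
have L0 : 0 <= L.
  have := noise_L1 Q I vs L HL [::] (fun=> 0) isT; rewrite big_nil normr0; exact.
pose A w := \sum_(j <- r) theta S j * I (phi j) w.
pose B w := \sum_(j <- r) 1 * (xi I j w ^+ 2 - Exi2 Q I j).
have [iA2 EA2] := noise_comb_sqr Q I _ HN r (theta S) ur r0.
have [iB2 EB2] := noise_L2 Q I sg vs L HN HL r (fun=> 1) ur r0 (cr _).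
have mI j : measurable_fun setT (I (phi j)).
  by apply: (measurable_noise Q I _ HN); exact: phi_L2.
have mA : measurable_fun setT A.
  by apply: measurable_sum => j; apply: measurable_funM => //; exact: measurable_cst.
have mB : measurable_fun setT B.
  apply: measurable_sum => j; apply: measurable_funM; first exact: measurable_cst.
  apply: measurable_funB; last exact: measurable_cst.
  by have /integrableP[/measurable_EFinP] := integrable_xi2 Q I _ HN j.
have EA : \int[Q]_w `|A w| <= 2 * D * Num.sqrt sg * (rn / q).
  apply: mean_abs_le => //.
    by rewrite !mulr_ge0 ?sqrtr_ge0 ?invr_ge0 ?(ltW rn0) ?(ltW q0).
  apply: le_trans EA2 _.
  rewrite !exprMn sqr_sqrtr ?(ltW sg0)// exprVn rn2 q2.
  apply: le_trans (_ : sg * n%:R * (4 * D ^+ 2 / rn) <= _).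
    by rewrite ler_wpM2l// mulr_ge0 ?(ltW sg0) ?ltW.
  by rewrite le_eqVlt; apply/orP; left; apply/eqP; field; rewrite gt_eqF.
have EB : \int[Q]_w `|B w| <= Num.sqrt L * rn.
  apply: mean_abs_le => //; first by rewrite mulr_ge0 ?sqrtr_ge0 ?(ltW rn0).
  apply: le_trans EB2 _; rewrite exprMn sqr_sqrtr// rn2 ler_wpM2l//.
  under eq_bigr do rewrite expr1n.
  by rewrite big_const_seq count_predT iter_addr addr0 szr ler_nat leq_subr.
have HL1 : `|\sum_(j <- r) 1 * (Exi2 Q I j - vs)| <= L.
  by apply: (noise_L1 Q I vs L HL r (fun=> 1) ur r0) => // j _; rewrite normr1.
pose F w := 4 * D ^+ 2 / rn + (L / n%:R + vs / rn) + 2 / n%:R * `|A w| + n%:R^-1 * `|B w|.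
have iA : Intg (fun w => `|A w|) by exact: (integrable_abse (integrable_of_sqr _ _ mA iA2)).
have iB : Intg (fun w => `|B w|) by exact: (integrable_abse (integrable_of_sqr _ _ mB iB2)).
have iA' : Intg (fun w => 2 / n%:R * `|A w|) by exact: integrableZ.
have iB' : Intg (fun w => n%:R^-1 * `|B w|) by exact: integrableZ.
have i1 : Intg (fun w => 4 * D ^+ 2 / rn + (L / n%:R + vs / rn) + 2 / n%:R * `|A w|).
  by apply: integrable_add => //; exact: integrable_prob_cst.
apply: le_trans (_ : \int[Q]_w F w <= _).
  apply: le_Rintegral => //.
  - have : Intg (fun w => sigma_hat n (observed S I w) - vs).
      apply: integrable_sub => //; last exact: integrable_prob_cst.
      exact: integrable_sigma_hat.
    exact: integrable_abse.
  - exact: integrable_add.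
  - move=> w _.
    have -> : sigma_hat n (observed S I w) - vs = \sum_(j <- r) theta S j ^+ 2
       + 2 / n%:R * A w + n%:R^-1 * B w
       + n%:R^-1 * \sum_(j <- r) 1 * (Exi2 Q I j - vs) - vs * (s%:R / n%:R).
      have -> : vs * (s%:R / n%:R) = vs - n%:R^-1 * \sum_(j <- r) vs.
        rewrite big_const_seq count_predT iter_addr addr0 szr -[vs *+ _]mulr_natr natrB//.
        by field; rewrite gt_eqF.
      rewrite opprB addrA; congr (_ - _).
      rewrite /A /B !mulr_sumr -!big_split /=; apply: eq_bigr => j _.
      rewrite theta_hat_observed /xi expr_div_n rn2.
      by field; rewrite gt_eqF.
    have absM (k z : R) : 0 <= k -> k * z <= k * `|z| /\ - (k * z) <= k * `|z|.
      by move=> k0; rewrite -mulrN !ler_wpM2l// ?ler_norm// -normrN ler_norm.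
    have [a1 a2] := absM (2 / n%:R) (A w) (divr_ge0 (ler0n _ 2) (ltW n0')).
    have [b1 b2] := absM n%:R^-1 (B w) (ltac:(by rewrite invr_ge0 ltW)).
    have [c1 c2] := absM n%:R^-1 (\sum_(j <- r) 1 * (Exi2 Q I j - vs))
      (ltac:(by rewrite invr_ge0 ltW)).
    have c3 : n%:R^-1 * `|\sum_(j <- r) 1 * (Exi2 Q I j - vs)| <= L / n%:R.
      by rewrite mulrC ler_wpM2r// invr_ge0 ltW.
    have t0 : 0 <= \sum_(j <- r) theta S j ^+ 2 by rewrite sumr_ge0// => j _; exact: sqr_ge0.
    have v1 : 0 <= vs * (s%:R / n%:R) by rewrite mulr_ge0 ?divr_ge0 ?ler0n// ltW.
    have v2 : vs * (s%:R / n%:R) <= vs / rn.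
      rewrite ler_pM2l// -rn2 ler_pdivrMr ?exprn_gt0// expr2 mulKf ?gt_eqF//.
    have v3 : 0 <= vs / rn by rewrite divr_ge0 ?(ltW vs0) ?(ltW rn0).
    have l3 : 0 <= L / n%:R by rewrite divr_ge0 ?(ltW n0').
    have e3 : 0 <= 4 * D ^+ 2 / rn by rewrite divr_ge0 ?(ltW rn0)// mulr_ge0// sqr_ge0.
    rewrite /F ler_norml; move: tail; rewrite -/r => tail.
    by apply/andP; split; lra.
rewrite /F RintegralD// RintegralD//; last exact: integrable_prob_cst.
rewrite Rintegral_prob_cst !RintegralZl//.
have h1 : 2 / n%:R * \int[Q]_w `|A w| <= 2 / n%:R * (2 * D * Num.sqrt sg * (rn / q)).
  by rewrite ler_wpM2l// divr_ge0// ltW.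
have h2 : n%:R^-1 * \int[Q]_w `|B w| <= n%:R^-1 * (Num.sqrt L * rn).
  by rewrite ler_wpM2l// invr_ge0 ltW.
apply: le_trans (lerD (lerD (lexx _) h1) h2) _.
rewrite -/q le_eqVlt; apply/orP; left; apply/eqP; rewrite -rn2.
by field; rewrite !gt_eqF.
Qed.

End SigmaHat.

(** * The oracle inequality under one noise law *)

Section LowerIntegral.
Context {d : measure_display} {Om : measurableType d} {R : realType}
  (mu : {measure set Om -> \bar R}).

(** A minimizer of the cost may depend on the observations in a
    non-measurable way.  The integral of a nonnegative function, being the
    supremum of the integrals of the simple functions below it, is nevertheless
    monotone. *)
Lemma ge0_le_integral_nonmeas (f g : Om -> \bar R) :
  (forall w, 0 <= f w)%E -> (forall w, f w <= g w)%E ->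
  (\int[mu]_w f w <= \int[mu]_w g w)%E.
Proof.
move=> f0 fg; rewrite !ge0_integralTE//; last by move=> w; exact: le_trans (fg w).
apply: ge_ereal_sup => _ [h hf <-]; apply: ereal_sup_ubound; exists h => // w.
exact: le_trans (hf w) (fg w).
Qed.

End LowerIntegral.

Section Support.
Context {R : realType}.
Implicit Types (g : nat -> R) (r : seq nat).

(** An infinite set is mapped to the empty finite set. *)
Lemma finite_supp g : (0 < nb_supp g)%N -> finite_set (supp g).
Proof. by rewrite /nb_supp /fset_set; case: pselect. Qed.

Lemma count_le_nb_supp g r : (0 < nb_supp g)%N -> uniq r ->
  {in r, forall j, 0 < j}%N -> (count (fun j => g j != 0%R) r <= nb_supp g)%N.
Proof.
move=> g0 ur r0; rewrite -size_filter; apply: uniq_leq_size.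
  exact: filter_uniq.
move=> j; rewrite mem_filter => /andP[gj jr].
have : j \in fset_set (supp g).
  rewrite in_fset_set ?inE /=; last exact: finite_supp.
  by split; [exact: r0|rewrite normr_gt0].
by [].
Qed.

Lemma sum_le_count g r : (forall j, 0 <= g j <= 1) ->
  \sum_(j <- r) g j <= (count (fun j => g j != 0%R) r)%:R.
Proof.
move=> g01; elim: r => [|j r IH]; first by rewrite big_nil.
rewrite big_cons /= natrD lerD//.
by case: eqVneq => [->|_] //=; case/andP: (g01 j).
Qed.

Lemma supp_bounded g : (0 < nb_supp g)%N ->
  exists N, forall j, (N < j)%N -> g j = 0.
Proof.
move=> g0; exists (\max_(j <- fset_set (supp g)) j)%N => j; apply: contraTeq => gj.
rewrite -leqNgt.
have [->//|j0] := posnP j.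
have : j \in fset_set (supp g).
  by rewrite in_fset_set ?inE /=; [split; rewrite ?normr_gt0|exact: finite_supp].
by move=> jS; apply: leq_bigmax_seq.
Qed.

Lemma common_bound (G : seq (nat -> R)) : (forall g, g \in G -> 0 < nb_supp g)%N ->
  exists N, forall g, g \in G -> forall j, (N < j)%N -> g j = 0.
Proof.
elim: G => [|g G IH] G0; first by exists 0%N.
have [|N HN] := IH; first by move=> f fG; apply: G0; rewrite inE fG orbT.
have [|M HM] := @supp_bounded g; first by apply: G0; rewrite inE eqxx.
exists (maxn M N) => f; rewrite inE => /predU1P[->|fG] j; rewrite gtn_max => /andP[Mj Nj].
  exact: HM.
exact: HN.
Qed.

End Support.

Section FixedLaw.
Context {R : realType} {n : nat} (Q : probability (D_space (n%:R : R)) R)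
  (I : (R -> R) -> D_space (n%:R : R) -> R) (sg vs L rho : R) (S dS : R -> R)
  (Gam : set (nat -> R)).
Notation Intg f := (Q.-integrable setT (EFin \o f)).
Notation leb := (@lebesgue_measure R).
Hypotheses (n0 : (0 < n)%N) (HN : noise_law Q sg I) (vs0 : 0 < vs).
Hypothesis HL : (L1n Q I vs + L2n Q I <= L%:E)%E.
Hypothesis SP : forall t, S (t + 1) = S t.
Hypothesis LS : L2 1 S.
Hypotheses (HC : C1_signal S dS) (HD : (L1norm dS < +oo)%E).
Hypothesis rho3 : 0 < rho < 3^-1.
Hypothesis finG : finite_set Gam.
Hypothesis HG : forall g, Gam g -> (forall j, 0 <= g j <= 1) /\ (0 < nb_supp g <= n)%N.

Let x (w : D_space (n%:R : R)) j := I (phi j) w / n%:R.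
Let T := \int[leb]_(t in `[0, 1]) (S t ^+ 2).
Let G := enum_fset (fset_set Gam).

Lemma mem_enumG g : (g \in G) = (g \in Gam).
Proof. by rewrite -[RHS]in_fset_set. Qed.

Lemma integral_S_hat_loss (g : nat -> R) N w : (forall j, (N < j)%N -> g j = 0) ->
  (\int[leb]_(t in `[0%R, 1%R])
     ((S_hat n g (observed S I w) t - S t) ^+ 2)%:E
   = (loss R (index_iota 1 N.+1) (theta S) (x w) T g)%:E)%E.
Proof.
move=> gN; set r := index_iota 1 N.+1.
have ur : uniq r by exact: iota_uniq.
have r0 : {in r, forall j, 0 < j}%N by move=> j; rewrite mem_index_iota => /andP[].
have gr j : (0 < j)%N -> j \notin r -> g j = 0.
  by move=> j0; rewrite mem_index_iota j0 /= -leqNgt => /gN.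
pose c j := g j * theta_hat n (observed S I w) j.
have E t : S_hat n g (observed S I w) t = \sum_(j <- r) c j * phi j t.
  by rewrite /S_hat (fsum_pos_idx r)// => j j0 jr; rewrite gr// !mul0r.
have LG := continuous_L2 1 _ (continuous_trig r c).
have i2 : leb.-integrable `[0, 1]
    (EFin \o (fun t => (\sum_(j <- r) c j * phi j t - S t) ^+ 2)).
  have -> : (fun t => (\sum_(j <- r) c j * phi j t - S t) ^+ 2) =
    (fun t => ((\sum_(j <- r) c j * phi j t) * (\sum_(j <- r) c j * phi j t)
     - 2 * ((\sum_(j <- r) c j * phi j t) * S t)) + S t * S t).
    by apply/funext => t; ring.
  have j1 := L2_integrableM _ _ _ LG LG.
  have j2 := L2_integrableM _ _ _ LG LS.
  have j3 := L2_integrableM _ _ _ LS LS.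
  apply: integrable_add => //; apply: integrable_sub => //.
  exact: integrableZ.
transitivity ((\int[leb]_(t in `[0, 1]) (\sum_(j <- r) c j * phi j t - S t) ^+ 2)%:E).
  rewrite /Rintegral fineK; last exact: (integrable_fin_num _ i2).
  by apply: eq_integral => t _; rewrite E.
rewrite integral_trig_err//; congr EFin; rewrite /loss -/T.
congr (_ - 2 * _ + _); apply: eq_bigr => j _.
  by rewrite /c theta_hat_observed// exprMn.
by rewrite /c theta_hat_observed.
Qed.

Lemma cost_coordinates (g : nat -> R) N w : (forall j, (N < j)%N -> g j = 0) ->
  cost n rho (observed S I w) g =
  coord_cost R (index_iota 1 N.+1) (theta S) (x w)
    (sigma_hat n (observed S I w) / n%:R) rho g.
Proof.
move=> gN; set r := index_iota 1 N.+1.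
have ur : uniq r by exact: iota_uniq.
have r0 : {in r, forall j, 0 < j}%N by move=> j; rewrite mem_index_iota => /andP[].
have gr j : (0 < j)%N -> j \notin r -> g j = 0.
  by move=> j0; rewrite mem_index_iota j0 /= -leqNgt => /gN.
rewrite /cost /coord_cost /penalty /sqnorm.
rewrite !(fsum_pos_idx r)//; try by move=> j j0 jr; rewrite gr// ?expr0n ?mul0r.
congr (_ - 2 * _ + rho * _).
- by apply: eq_bigr => j _; rewrite theta_hat_observed.
- by apply: eq_bigr => j _; rewrite /theta_tilde theta_hat_observed.
- by rewrite mulrAC.
Qed.

(** This is oracle_expectation for X j = I (phi j) / n: the linear noise has
    sg / n for variance factor, and the functionals L1n and L2n, which concern
    xi j = I (phi j) / sqrt n, are scaled by 1 / n and 1 / n^2. *)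
Lemma fixed_law_oracle (ghat : ((R -> R) -> R) -> nat -> R) g0 :
  cost_minimizer n Gam rho ghat -> Gam g0 ->
  exists rk : R, risk S Q I (S_hat n g0) = rk%:E /\ 0 <= rk /\
  (risk S Q I (S_select n ghat) <=
   ((1 + 3 * rho - 2 * rho ^+ 2) / (1 - 3 * rho) * rk +
    n%:R^-1 * ((2 * (nu Gam)%:R * sg / rho + 2 * (nu Gam)%:R * (L / vs) / rho
         + (4 + 2 * rho) * L + 2 * (mu Gam)%:R *
    ((4 * fine (L1norm dS) ^+ 2 + vs + Num.sqrt L
   + 4 * fine (L1norm dS) * Num.sqrt sg / n%:R `^ 4^-1 + L / Num.sqrt n%:R)
  / Num.sqrt n%:R)) / (1 - 3 * rho)))%:E)%E.
Proof.
move=> Hmin Gg0; have n0' : 0 < n%:R :> R by rewrite ltr0n.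
have GG g : g \in G -> (forall j, 0 <= g j <= 1) /\ (0 < nb_supp g <= n)%N.
  by rewrite mem_enumG inE; exact: HG.
(* All the sums may run over 1 <= j <= N, beyond which every weight of the
   class vanishes. *)
have [|N HNb] := @common_bound R G; first by move=> g /GG[_ /andP[]].
pose r := index_iota 1 N.+1.
have ur : uniq r by exact: iota_uniq.
have r0 : {in r, forall j, 0 < j}%N by move=> j; rewrite mem_index_iota => /andP[].
pose X j w := I (phi j) w / n%:R.
pose s w := sigma_hat n (observed S I w) / n%:R.
pose a := theta S; pose v := vs / n%:R; pose vj j := Exi2 Q I j / n%:R.
have cnt g : g \in G -> (count (fun j => g j != 0%R) r <= n)%N.
  by move=> /GG[_ /andP[g1 g2]]; apply: leq_trans g2; exact: count_le_nb_supp.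
have mug g : g \in G -> (nb_supp g <= mu Gam)%N.
  by move=> gG; apply: leq_bigmax_seq.
have sg0 : 0 < sg by case: HN.
have L0 : 0 <= L.
  have := noise_L1 Q I vs L HL [::] (fun=> 0) isT; rewrite big_nil normr0; exact.
have v0 : 0 < v by rewrite divr_gt0.
have Lp j := phi_L2 (n%:R : R) j.
have XE (c : nat -> R) w : \sum_(j <- r) c j * X j w =
    n%:R^-1 * \sum_(j <- r) c j * I (phi j) w.
  by rewrite mulr_sumr; apply: eq_bigr => j _; rewrite /X mulrA mulrC.
have XXE j w : X j w ^+ 2 = n%:R^-1 * xi I j w ^+ 2.
  rewrite /X /xi !expr_div_n sqr_sqrtr ?ler0n//; field.
  by rewrite gt_eqF.
have chiE (c : nat -> R) w : \sum_(j <- r) c j * (X j w ^+ 2 - vj j) =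
    n%:R^-1 * \sum_(j <- r) c j * (xi I j w ^+ 2 - Exi2 Q I j).
  by rewrite mulr_sumr; apply: eq_bigr => j _; rewrite XXE /vj; ring.
have iX j : Intg (X j).
  have [i1 _] := noise_mean Q I _ HN _ (Lp j).
  have -> : X j = (fun w => n%:R^-1 * I (phi j) w) by apply/funext => w; rewrite /X mulrC.
  exact: integrableZ.
have EX j : \int[Q]_w X j w = 0.
  have [i1 e1] := noise_mean Q I _ HN _ (Lp j).
  by rewrite RintegralZr// e1 mul0r.
have ix2 j := integrable_xi2 Q I _ HN j.
have iX2 j : Intg (fun w => X j w ^+ 2).
  have -> : (fun w => X j w ^+ 2) = (fun w => n%:R^-1 * xi I j w ^+ 2).
    by apply/funext => w; rewrite XXE.
  exact: integrableZ.
have EX2 j : \int[Q]_w (X j w ^+ 2) = vj j.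
  by under eq_Rintegral do rewrite XXE; rewrite RintegralZl// -Exi2E mulrC.
have HX2 (c : nat -> R) := noise_comb_sqr Q I _ HN r c ur r0.
have iLX (c : nat -> R) : Intg (fun w => (\sum_(j <- r) c j * X j w) ^+ 2).
  have -> : (fun w => (\sum_(j <- r) c j * X j w) ^+ 2) =
      (fun w => n%:R^-1 ^+ 2 * (\sum_(j <- r) c j * I (phi j) w) ^+ 2).
    by apply/funext => w; rewrite XE exprMn.
  by apply: integrableZ => //; exact: (HX2 c).1.
have ELX (c : nat -> R) : \int[Q]_w ((\sum_(j <- r) c j * X j w) ^+ 2)
    <= sg / n%:R * \sum_(j <- r) c j ^+ 2.
  under eq_Rintegral do rewrite XE exprMn.
  rewrite RintegralZl//; last exact: (HX2 c).1.
  apply: le_trans (ler_wpM2l _ (HX2 c).2) _; first exact: sqr_ge0.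
  rewrite le_eqVlt; apply/orP; left; apply/eqP.
  by field; rewrite gt_eqF.
have ints : Intg s.
  have -> : s = (fun w => n%:R^-1 * sigma_hat n (observed S I w)).
    by apply/funext => w; rewrite /s mulrC.
  by apply: integrableZ => //; exact: (integrable_sigma_hat Q I sg).
have GL1 g : g \in G -> `|\sum_(j <- r) g j * (vj j - v)| <= L / n%:R /\
    `|\sum_(j <- r) g j ^+ 2 * (vj j - v)| <= L / n%:R.
  move=> gG; have [g01 _] := GG g gG.
  have vE (c : nat -> R) : \sum_(j <- r) c j * (vj j - v) =
      (\sum_(j <- r) c j * (Exi2 Q I j - vs)) / n%:R.
    by rewrite mulr_suml; apply: eq_bigr => j _; rewrite /vj /v; ring.
  rewrite !vE !normrM !(ger0_norm (_ : 0 <= n%:R^-1)) ?invr_ge0 ?ler0n//.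
  split; (rewrite ler_pM2r ?invr_gt0//; apply: (noise_L1 Q I vs L HL) => //).
  - by move=> j _; have /andP[h1 h2] := g01 j; rewrite ger0_norm.
  - exact: cnt.
  - move=> j _; have /andP[h1 h2] := g01 j.
    by rewrite ger0_norm ?sqr_ge0// expr_le1.
  - rewrite (eq_count (a2 := fun j => g j != 0%R)); first exact: cnt.
    by move=> j /=; rewrite sqrf_eq0.
have GL2 g : g \in G ->
  Intg (fun w => (\sum_(j <- r) g j * (X j w ^+ 2 - vj j)) ^+ 2) /\
  \int[Q]_w ((\sum_(j <- r) g j * (X j w ^+ 2 - vj j)) ^+ 2)
    <= L / n%:R ^+ 2 * \sum_(j <- r) g j ^+ 2.
  move=> gG; have [i2 e2] := noise_L2 Q I sg vs L HN HL r g ur r0 (cnt g gG).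
  have E : (fun w => (\sum_(j <- r) g j * (X j w ^+ 2 - vj j)) ^+ 2) = (fun w =>
      n%:R^-1 ^+ 2 * (\sum_(j <- r) g j * (xi I j w ^+ 2 - Exi2 Q I j)) ^+ 2).
    by apply/funext => w; rewrite chiE exprMn.
  rewrite E; split; first exact: integrableZ.
  rewrite RintegralZl//; apply: le_trans (ler_wpM2l _ e2) _; first exact: sqr_ge0.
  by rewrite mulrA exprVn (mulrC _ L).
have Gsum g : g \in G -> \sum_(j <- r) g j <= (mu Gam)%:R /\ 0 < \sum_(j <- r) g j ^+ 2.
  move=> gG; have [g01 /andP[g1 g2]] := GG g gG; split.
    apply: le_trans (sum_le_count g r g01) _; rewrite ler_nat.
    by apply: leq_trans (mug g gG); exact: count_le_nb_supp.
  rewrite lt_neqAle sumr_ge0 ?andbT//; last by move=> j _; exact: sqr_ge0.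
  apply/negP => /eqP/esym z; move: g1; rewrite /nb_supp.
  rewrite (_ : supp g = set0) ?fset_set0 ?cardfs0//.
  rewrite -subset0 => j [j0]; rewrite normr_gt0 => /negP; apply.
  have [jr|jr] := boolP (j \in r).
    move/eqP : z; rewrite psumr_eq0; last by move=> i _; exact: sqr_ge0.
    by move=> /allP/(_ j jr); rewrite /= sqrf_eq0.
  by apply/eqP; apply: (HNb g gG); move: jr; rewrite mem_index_iota j0 /= -leqNgt.
have g0G : g0 \in G by rewrite mem_enumG inE.
have aT : \sum_(j <- r) a j ^+ 2 <= T by exact: bessel.
have [M [iM HM EM]] := @oracle_expectation _ _ _ Q r a vj X s T v rho (mu Gam)%:R
  (L / n%:R) (L / n%:R ^+ 2) (sg / n%:R) G rho3 v0
  (divr_ge0 (ltW sg0) (ltW n0')) (divr_ge0 L0 (exprn_ge0 2 (ltW n0')))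
  aT iX EX iX2 EX2 iLX ELX ints (fun g gG => (GG g gG).1) Gsum GL1
  (fun g gG => (GL2 g gG).1) (fun g gG => (GL2 g gG).2) g0 g0G.
have ierr := @integrable_err _ _ _ Q r a X T iX iX2 g0.
pose err g w := loss R r a (fun j => X j w) T g.
have errE g w : g \in G -> (\int[leb]_(t in `[0%R, 1%R])
     ((S_hat n g (observed S I w) t - S t) ^+ 2)%:E = (err g w)%:E)%E.
  by move=> gG; rewrite (@integral_S_hat_loss g N)//; exact: HNb.
have err0 g w : g \in G -> 0 <= err g w.
  move=> gG; rewrite -lee_fin -errE//; apply: integral_ge0 => t _.
  by rewrite lee_fin sqr_ge0.
exists (\int[Q]_w err g0 w); split; [|split].
- rewrite /risk -Rintegral_EFin//; apply: eq_integral => w _; exact: errE.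
- by apply: Rintegral_ge0 => w _; exact: err0.
- apply: le_trans (_ : (\int[Q]_w (M w)%:E <= _)%E); last first.
    rewrite Rintegral_EFin// lee_fin; apply: le_trans EM _.
    rewrite lerD2l (_ : size G = nu Gam)// (mulrA n%:R^-1) ler_pM2r ?invr_gt0//; last first.
      by have /andP[_ ?] := rho3; lra.
    have Es : \int[Q]_w `|s w - v| = n%:R^-1 * \int[Q]_w `|sigma_hat n (observed S I w) - vs|.
      rewrite -RintegralZl//; last first.
        have : Intg (fun w => sigma_hat n (observed S I w) - vs).
          apply: integrable_sub => //; last exact: integrable_prob_cst.
          exact: (integrable_sigma_hat Q I sg).
        exact: integrable_abse.
      apply: eq_Rintegral => w _; rewrite /s /v -mulrBl normrM mulrC.
      by congr (_ * _); apply: ger0_norm; rewrite invr_ge0 ltW.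
    have := sigma_hat_error Q I sg vs L S dS n0 HN vs0 HL SP LS HC HD.
    set E := \int[Q]_w _; set K := _ / _ => EK.
    rewrite Es -/E.
    have h : n%:R^-1 * (2 * (mu Gam)%:R * E) <= n%:R^-1 * (2 * (mu Gam)%:R * K).
      by rewrite ler_pM2l ?invr_gt0// ler_wpM2l// mulr_ge0.
    have -> : L / n%:R ^+ 2 / v = n%:R^-1 * (L / vs).
      by rewrite /v; field; rewrite (gt_eqF vs0) gt_eqF.
    by rewrite !mulrDr; lra.
  rewrite /risk; apply: ge0_le_integral_nonmeas => w.
    by apply: integral_ge0 => t _; rewrite lee_fin sqr_ge0.
  have [Gh ch] := Hmin (observed S I w).
  have gG : ghat (observed S I w) \in G by rewrite mem_enumG inE.
  rewrite /S_select errE// lee_fin; apply: HM => //.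
  have := ch g0 Gg0.
  by rewrite (@cost_coordinates _ N) ?(@cost_coordinates g0 N)//; exact: HNb.
Qed.

End FixedLaw.

(** * Subpolynomial sequences and the size of the weight class *)

Section Subpolynomial.
Context {R : realType}.
Implicit Types u v : nat -> R.

Definition subpoly u := forall delta : R, 0 < delta ->
  u n / n%:R `^ delta @[n --> \oo] --> (0 : R).

Lemma subpoly_le u v : (\forall n \near \oo, `|u n| <= `|v n|) ->
  subpoly v -> subpoly u.
Proof.
move=> uv sv dl d0; have /cvgrPdist_lt h := sv dl d0.
apply/cvgrPdist_lt => e /h; move: uv; apply: filterS2 => n uv.
rewrite !sub0r !normrN !normrM; apply: le_lt_trans.
by rewrite ler_wpM2r.
Qed.

Lemma subpolyD u v : subpoly u -> subpoly v -> subpoly (fun n => u n + v n).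
Proof.
move=> su sv dl d0; rewrite -[X in _ --> X]addr0.
under eq_fun do rewrite mulrDl.
by apply: cvgD; [exact: su|exact: sv].
Qed.

(** The power n^delta is shared equally between the two factors. *)
Lemma subpolyM u v : subpoly u -> subpoly v -> subpoly (fun n => u n * v n).
Proof.
move=> su sv dl d0; have d2 : 0 < dl / 2 by rewrite divr_gt0.
have : (u n / n%:R `^ (dl / 2)) * (v n / n%:R `^ (dl / 2)) @[n --> \oo] --> (0 * 0 : R).
  by apply: cvgM; [exact: su|exact: sv].
rewrite mul0r; apply: cvg_trans; apply: near_eq_cvg; near=> n.
rewrite [in RHS](_ : n%:R `^ dl = n%:R `^ (dl / 2) * n%:R `^ (dl / 2)).
  by rewrite invfM; ring.
have dE : dl = dl / 2 + dl / 2 by field.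
by rewrite -powRD -?dE// gt_eqF.
Unshelve. all: end_near. Qed.

Lemma subpolyV (u : nat -> R) : (forall n, (0 < n)%N -> 0 < u n) ->
  (forall delta : R, 0 < delta -> n%:R `^ delta * u n @[n --> \oo] --> +oo) ->
  subpoly (fun n => (u n)^-1).
Proof.
move=> u0 h dl d0.
have := h dl d0.
have pos : \forall n \near \oo, 0 < n%:R `^ dl * u n.
  near=> n; have n0 : (0 < n)%N by near: n; exists 1%N.
  by rewrite mulr_gt0 ?u0// powR_gt0// ltr0n.
rewrite -(gtr0_cvgV0 pos).
apply: cvg_trans; apply: near_eq_cvg; near=> n.
by rewrite /= invfM mulrC.
Unshelve. all: end_near. Qed.

(** delta * ln n = ln (n^delta) <= n^delta. *)
Lemma subpoly_of_ln u : u n / ln n%:R @[n --> \oo] --> (0 : R) -> subpoly u.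
Proof.
move=> h dl d0; have /cvgrPdist_lt h' := h.
apply/cvgrPdist_lt => e e0; near=> n.
have n1 : 1 < n%:R :> R by rewrite ltr1n; near: n; exists 2%N.
have ln0 : 0 < ln (n%:R : R) by rewrite ln_gt0.
have p0 : 0 < (n%:R : R) `^ dl by rewrite powR_gt0// (lt_trans _ n1).
have lp : dl * ln n%:R <= (n%:R : R) `^ dl.
  by rewrite -ln_powR ltW// ln_sublinear.
have : `|0 - u n / ln n%:R| < e * dl.
  by near: n; apply: h'; rewrite mulr_gt0.
rewrite !sub0r !normrN !normrM !normfV (gtr0_norm ln0) (gtr0_norm p0).
rewrite !ltr_pdivrMr// => /lt_le_trans; apply.
by rewrite -mulrA ler_pM2l.
Unshelve. all: end_near. Qed.

End Subpolynomial.

Section WeightClass.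
Context {R : realType}.

Lemma weights_sub_seq n k (eps : R) :
  weights n k eps `<=` [set` [seq weight n b (i%:R * eps) |
    b <- iota 1 k, i <- iota 1 (Num.truncn (eps ^- 2))]].
Proof.
move=> g [b [i [/andP[b1 bk] /andP[i1 im] ->]]] /=.
by apply/allpairsP; exists (b, i); split; rewrite //= mem_iota ?b1 ?i1 ltnS.
Qed.

Lemma finite_weights n k (eps : R) : finite_set (weights n k eps).
Proof. by apply: sub_finite_set (@weights_sub_seq n k eps) _; exact: finite_seq. Qed.

Lemma nu_weights n k (eps : R) :
  (nu (weights n k eps) <= k * Num.truncn (eps ^- 2))%N.
Proof.
rewrite -[leqRHS](_ : size [seq weight n b (i%:R * eps) |
    b <- iota 1 k, i <- iota 1 (Num.truncn (eps ^- 2))] = _); last first.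
  by rewrite size_allpairs !size_iota.
apply: uniq_leq_size; first exact: fset_uniq.
move=> g; have : g \in fset_set (weights n k eps) -> g \in weights n k eps.
  by rewrite in_fset_set//; exact: finite_weights.
by move=> /[apply]; rewrite inE => /weights_sub_seq.
Qed.

(** (b + 1) / b <= 2 and pi^(2 b) >= 4^b >= 1 + 3 b >= 2 b + 1. *)
Lemma tau_le2 (b : nat) : (0 < b)%N -> tau_ R b <= 2.
Proof.
move=> b0; have b0' : 0 < b%:R :> R by rewrite ltr0n.
have p2 : ((1 + 3 * b)%N)%:R <= (pi : R) ^+ (2 * b).
  apply: le_trans (_ : 2 ^+ (2 * b) <= _); last first.
    by rewrite lerXn2r ?nnegrE ?pi_ge2// pi_ge0.
  rewrite exprM -natrX -natrX ler_nat.
  by elim: b {b0 b0'} => // b IH; rewrite expnS; lia.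
rewrite /tau_ ler_pdivrMr ?mulr_gt0 ?exprn_gt0 ?pi_gt0//.
apply: le_trans (_ : 2 * ((1 + 3 * b)%N%:R * b%:R) <= _); last first.
  by rewrite ler_pM2l// ler_pM2r.
by rewrite -natrM -natrM ler_nat; nia.
Qed.

(** The exponent 1 / (2 b + 1) is rounded up to 1 / 2, the base being at most
    2 n / eps >= 1: a bound of order sqrt n is enough, since B1 contains mu only
    through mu / sqrt n. *)
Lemma omega_le (n b i : nat) (eps : R) : (0 < n)%N -> (0 < b)%N -> 0 < eps <= 1 ->
  (i <= Num.truncn (eps ^- 2))%N -> omega n b (i%:R * eps) <= Num.sqrt (2 * n%:R / eps).
Proof.
move=> n0 b0 /andP[e0 e1] im.
have n1 : 1 <= n%:R :> R by rewrite ler1n.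
have y1 : 1 <= 2 * n%:R / eps by rewrite ler_pdivlMr//; lra.
have ie : i%:R * eps <= eps^-1.
  have : i%:R <= eps ^- 2.
    apply: (@le_trans _ _ (Num.truncn (eps ^- 2))%:R); first by rewrite ler_nat.
    by rewrite truncn_le// invr_ge0 exprn_ge0// ltW.
  rewrite -(ler_pM2r e0); move=> /le_trans; apply.
  by rewrite le_eqVlt; apply/orP; left; apply/eqP; field; rewrite gt_eqF.
have t0 : 0 <= tau_ R b.
  by rewrite /tau_ divr_ge0// mulr_ge0// exprn_ge0// pi_ge0.
have ie0 : 0 <= i%:R * eps by rewrite mulr_ge0// ltW.
have y0 : 0 <= tau_ R b * (i%:R * eps) * n%:R by apply: mulr_ge0; [exact: mulr_ge0|exact: ler0n].
have yy : tau_ R b * (i%:R * eps) * n%:R <= 2 * n%:R / eps.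
  rewrite [leRHS]mulrAC ler_wpM2r//.
  by apply: ler_pM => //; exact: tau_le2.
rewrite /omega -powR12_sqrt; last by lra.
apply: le_trans (_ : (2 * n%:R / eps) `^ ((2 * b + 1)%:R^-1) <= _).
  by rewrite ge0_ler_powR ?nnegrE ?invr_ge0//; lra.
rewrite ler_powR// lef_pV2 ?posrE// ?ltr0n ?addn1// ler_nat.
by lia.
Qed.

(** Beyond omega the second part of the weight vanishes, and the first part
    too because ln n >= 1 gives j0 <= omega. *)
Lemma nb_supp_weight n b (t : R) : 1 <= ln n%:R :> R ->
  (nb_supp (weight n b t))%:R <= omega n b t.
Proof.
move=> l1; have om0 : 0 <= omega n b t by exact: powR_ge0.
set om := omega n b t.
apply: le_trans (_ : (Num.truncn om)%:R <= _); last by rewrite truncn_le.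
rewrite ler_nat; apply: geq_card_fset_set.
apply: (supp_card_le (iota 1 (Num.truncn om))); last by rewrite size_iota.
move=> j j0; rewrite mem_iota add1n ltnS j0 /=; apply: contraR.
rewrite -ltnNge => jom; have omj : om < j%:R.
  by apply: lt_le_trans (truncnS_gt om) _; rewrite ler_nat.
rewrite /weight -/om (leNgt _ om) omj andbF mulr0 addr0 j0 /=.
rewrite (_ : (j <= _)%N = false)//; apply/negbTE; rewrite -ltnNge.
apply: leq_ltn_trans jom; apply: le_truncn.
by rewrite ler_pdivrMr ?(lt_le_trans ltr01)// ler_peMr.
Qed.

Lemma mu_weights n k (eps : R) : (0 < n)%N -> 1 <= ln n%:R :> R -> 0 < eps <= 1 ->
  (mu (weights n k eps))%:R <= Num.sqrt (2 * n%:R / eps).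
Proof.
move=> n0 l1 e01; rewrite /mu.
have : forall g, g \in fset_set (weights n k eps) ->
    (nb_supp g)%:R <= Num.sqrt (2 * n%:R / eps).
  move=> g; rewrite in_fset_set; last exact: finite_weights.
  rewrite inE => -[b [i [/andP[b1 _] /andP[_ im] ->]]].
  apply: le_trans (@omega_le n b i eps n0 b1 e01 im); exact: nb_supp_weight.
move: (fset_set _) => F HF; rewrite big_seq.
apply: (big_ind (fun m : nat => m%:R <= Num.sqrt (2 * n%:R / eps))).
- exact: sqrtr_ge0.
- by move=> x y hx hy; rewrite /maxn; case: ifP.
- by move=> g gF; exact: HF.
Qed.

End WeightClass.

(** * The remainder term and the robust oracle inequality *)

(** The terms are compared one by one, using 1 <= vhi / vlo and
    (4 + 2 rho) rho <= 4. *)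
Lemma fixed_law_le_B1 (R : realType) (n nu mu : nat) (sg vs vlo vhi shi L D rho : R) :
  (0 < n)%N -> 0 < rho < 3^-1 -> 0 < vlo -> vlo <= vs -> vs <= vhi ->
  0 < sg -> sg <= shi -> 0 <= L -> 0 <= D ->
  (2 * nu%:R * sg / rho + 2 * nu%:R * (L / vs) / rho
         + (4 + 2 * rho) * L + 2 * mu%:R *
    ((4 * D ^+ 2 + vs + Num.sqrt L
   + 4 * D * Num.sqrt sg / n%:R `^ 4^-1 + L / Num.sqrt n%:R)
  / Num.sqrt n%:R)) / (1 - 3 * rho) <= B1 vlo vhi shi D n L nu mu rho.
Proof.
move=> n0 /andP[r0 r3] vlo0 vl vh sg0 sh L0 D0; rewrite /B1.
have r3' : 0 < 1 - 3 * rho by lra.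
have vs0 : 0 < vs by exact: lt_le_trans vl.
have sn0 : 0 < Num.sqrt n%:R :> R by rewrite sqrtr_gt0 ltr0n.
have q0 : 0 < (n%:R : R) `^ 4^-1 by rewrite powR_gt0 ?ltr0n.
set rn := Num.sqrt n%:R in sn0 *; set q := n%:R `^ 4^-1 in q0 *.
set kQ := 4 * D ^+ 2 + vs + _ + _ + _.
set kS := 4 * D ^+ 2 + vhi + _ + _ + _.
(* The bound kQ for the given law is monotone in vs and sg. *)
have kQS : kQ <= kS.
  rewrite /kQ /kS lerD2r lerD//; first by rewrite lerD2r lerD2l.
  rewrite ler_pM2r ?invr_gt0// ler_wpM2l ?mulr_ge0// ler_wsqrtr//.
have kQ0 : 0 <= kQ.
  by rewrite /kQ !addr_ge0 ?mulr_ge0 ?sqr_ge0 ?sqrtr_ge0 ?invr_ge0 ?(ltW vs0) ?(ltW sn0) ?(ltW q0).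
rewrite (_ : (_ + _) / (vlo * rho * (1 - 3 * rho)) + _ =
   ((2 * vhi * shi * nu%:R + 4 * vhi * L + 2 * nu%:R * L) / (vlo * rho)
    + 6 * mu%:R * (kS / rn)) / (1 - 3 * rho)); last first.
  by field; rewrite (gt_eqF sn0) (gt_eqF r3') (gt_eqF r0) gt_eqF.
rewrite ler_pM2r ?invr_gt0//.
have vr0 : 0 < vlo * rho by rewrite mulr_gt0.
have h1 : 2 * nu%:R * sg / rho <= 2 * vhi * shi * nu%:R / (vlo * rho).
  rewrite ler_pdivlMr// (_ : _ / rho * _ = 2 * nu%:R * (vlo * sg)); last first.
    by field; rewrite gt_eqF.
  rewrite (_ : 2 * vhi * shi * _ = 2 * nu%:R * (vhi * shi)); last by ring.
  rewrite ler_wpM2l ?mulr_ge0 ?ler0n// ler_pM ?(ltW vlo0) ?(ltW sg0)//.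
  exact: le_trans vh.
have h2 : 2 * nu%:R * (L / vs) / rho <= 2 * nu%:R * L / (vlo * rho).
  rewrite (_ : 2 * nu%:R * L / (vlo * rho) = 2 * nu%:R * (L / vlo) / rho); last first.
    by field; rewrite (gt_eqF vlo0) gt_eqF.
  rewrite ler_pM2r ?invr_gt0// ler_wpM2l ?mulr_ge0 ?ler0n// ler_wpM2l//.
  by rewrite lef_pV2 ?posrE.
have h3 : (4 + 2 * rho) * L <= 4 * vhi * L / (vlo * rho).
  rewrite ler_pdivlMr// (_ : (4 + 2 * rho) * L * _ = (vlo * ((4 + 2 * rho) * rho)) * L); last by ring.
  rewrite ler_wpM2r// [leRHS]mulrC ler_pM ?(ltW vlo0)//.
  - by rewrite mulr_ge0 ?(ltW r0)//; lra.
  - exact: le_trans vh.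
  - have : rho * rho <= rho * 3^-1 by rewrite ler_pM2l// ltW.
    lra.
have h4 : 2 * mu%:R * (kQ / rn) <= 6 * mu%:R * (kS / rn).
  have m0 : 0 <= mu%:R * (kQ / rn) by rewrite mulr_ge0 ?ler0n// divr_ge0 ?(ltW sn0).
  have : mu%:R * (kQ / rn) <= mu%:R * (kS / rn).
    by rewrite ler_wpM2l ?ler0n// ler_pM2r ?invr_gt0.
  lra.
by rewrite !(mulrDl _ _ (vlo * rho)^-1) lerD// [leRHS]addrAC !lerD.
Qed.

(** A constant is dominated by its product with any sequence that is at least
    1, here a subpolynomial one. *)
Lemma subpoly_cst (R : realType) (u : nat -> R) (c : R) :
  (\forall n \near \oo, 1 <= u n) -> subpoly u -> subpoly (fun=> c).
Proof.
move=> u1 su; have scu : subpoly (fun n => c * u n).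
  move=> dl d0; rewrite -[X in _ --> X](mulr0 c).
  under eq_fun do rewrite -mulrA.
  by apply: cvgM; [exact: cvg_cst|exact: su].
apply: subpoly_le scu; move: u1; apply: filterS => n un.
by rewrite normrM ler_peMr// (le_trans un)// ler_norm.
Qed.

(** As nu <= k / eps^2 and mu / sqrt n <= 2 / eps, every factor of the
    remainder is subpolynomial. *)
Lemma B1_subpoly (R : realType) (l : nat -> R) (vlo vhi shi D : R)
  (k : nat -> nat) (eps rho : nat -> R) :
  (forall n, (0 < n)%N -> 0 < l n) -> subpoly l -> 0 < vlo ->
  (forall n, (0 < n)%N -> (1 <= k n)%N) ->
  (k n)%:R / ln n%:R @[n --> \oo] --> (0 : R) ->
  (forall n, (0 < n)%N -> 0 < eps n <= 1) ->
  (forall delta : R, 0 < delta -> n%:R `^ delta * eps n @[n --> \oo] --> +oo) ->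
  (forall n, (0 < n)%N -> 0 < rho n < 3^-1) ->
  rho n @[n --> \oo] --> (0 : R) ->
  (forall delta : R, 0 < delta -> n%:R `^ delta * rho n @[n --> \oo] --> +oo) ->
  subpoly (fun n => B1 vlo vhi shi D n (l n) (nu (weights n (k n) (eps n)))
                      (mu (weights n (k n) (eps n))) (rho n)).
Proof.
move=> l0 sl vlo0 k1 kln e01 he r01 rho0 hr.
have sk : subpoly (fun n => (k n)%:R : R) by exact: subpoly_of_ln.
have sc c : subpoly (fun=> c : R).
  by apply: subpoly_cst sk; near=> n; rewrite ler1n k1//; near: n; exists 1%N.
have sie : subpoly (fun n => (eps n)^-1).
  by apply: subpolyV => // n /e01 /andP[].
have sir : subpoly (fun n => (rho n)^-1).
  by apply: subpolyV => // n /r01 /andP[].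
have snu : subpoly (fun n => (nu (weights n (k n) (eps n)))%:R : R).
  have := subpolyM _ _ sk (subpolyM _ _ sie sie); apply: subpoly_le; near=> n.
  have n0 : (0 < n)%N by near: n; exists 1%N.
  have /andP[en0 en1] := e01 n n0.
  rewrite !ger0_norm ?ler0n ?mulr_ge0 ?invr_ge0 ?ler0n ?(ltW en0)//.
  apply: (@le_trans _ _ ((k n * Num.truncn (eps n ^- 2))%N%:R)).
    by rewrite ler_nat nu_weights.
  rewrite natrM ler_wpM2l ?ler0n// -invfM -expr2 truncn_le// invr_ge0 exprn_ge0//.
  exact: ltW.
have smu : subpoly (fun n => (mu (weights n (k n) (eps n)))%:R / Num.sqrt n%:R : R).
  have := subpolyM _ _ (sc 2) sie; apply: subpoly_le; near=> n.
  have n0 : (0 < n)%N by near: n; exists 1%N.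
  have /andP[en0 en1] := e01 n n0.
  have n0' : 0 < n%:R :> R by rewrite ltr0n.
  have sn0 : 0 < Num.sqrt n%:R :> R by rewrite sqrtr_gt0.
  have ln1 : 1 <= ln n%:R :> R.
    rewrite -[leLHS](@expRK R) ler_ln ?posrE ?expR_gt0//.
    near: n; exact: nbhs_infty_ger.
  rewrite !ger0_norm ?divr_ge0 ?ler0n ?mulr_ge0 ?invr_ge0 ?(ltW en0) ?(ltW sn0)//.
  rewrite ler_pdivrMr//; apply: le_trans (@mu_weights R n _ _ n0 ln1 (e01 n n0)) _.
  rewrite (_ : 2 * n%:R / eps n = 2 / eps n * n%:R); last by rewrite mulrAC.
  rewrite sqrtrM ?divr_ge0 ?(ltW en0)// ler_pM2r//.
  have y1 : 1 <= 2 / eps n by rewrite ler_pdivlMr//; lra.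
  have y0 : 0 <= 2 / eps n by lra.
  rewrite -[X in _ <= X]sqr_sqrtr// expr2 ler_peMl ?sqrtr_ge0//.
  by rewrite -[X in X <= _]sqrtr1 ler_wsqrtr.
have sr3 : subpoly (fun n => (1 - 3 * rho n)^-1).
  have := sc 2; apply: subpoly_le; near=> n.
  have r6 : rho n < 6^-1 by near: n; apply: (cvgr_lt _ rho0).
  have rp : 0 < 1 - 3 * rho n by lra.
  rewrite (gtr0_norm (_ : 0 < 2))// gtr0_norm ?invr_gt0//.
  by rewrite invf_ple ?posrE//; lra.
have ssl : subpoly (fun n => Num.sqrt (l n)).
  have := subpolyD _ _ (sc 1) sl; apply: subpoly_le; near=> n.
  have n0 : (0 < n)%N by near: n; exists 1%N.
  have ln0 := l0 n n0.
  rewrite !ger0_norm ?sqrtr_ge0 ?addr_ge0 ?(ltW ln0)//.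
  have := sqr_sqrtr (ltW ln0); have := sqrtr_ge0 (l n).
  by move: (Num.sqrt _) => s s0 <-; have := sqr_ge0 (s - 1); rewrite sqrrB1; lra.
have snn : subpoly (fun n => (Num.sqrt n%:R)^-1 : R).
  have := sc 1; apply: subpoly_le; near=> n.
  have n0 : (0 < n)%N by near: n; exists 1%N.
  have sn1 : 1 <= Num.sqrt n%:R :> R by rewrite -[leLHS]sqrtr1 ler_wsqrtr// ler1n.
  rewrite normr1 ger0_norm ?invr_ge0 ?sqrtr_ge0// invf_le1//.
  exact: lt_le_trans sn1.
have sq4 : subpoly (fun n => (n%:R `^ 4^-1)^-1 : R).
  have := sc 1; apply: subpoly_le; near=> n.
  have n0 : (0 < n)%N by near: n; exists 1%N.
  have sn1 : 1 <= n%:R `^ 4^-1 :> R.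
    by rewrite -[leLHS](powRr0 n%:R) ler_powR ?ler1n// invr_ge0.
  rewrite normr1 ger0_norm ?invr_ge0 ?powR_ge0// invf_le1//.
  exact: lt_le_trans sn1.
pose nun n := (nu (weights n (k n) (eps n)))%:R : R.
pose mun n := (mu (weights n (k n) (eps n)))%:R / Num.sqrt n%:R : R.
suff : subpoly (fun n => (2 * vhi * shi * nun n + 4 * vhi * l n + 2 * (nun n * l n))
   * (vlo^-1 * ((rho n)^-1 * (1 - 3 * rho n)^-1))
   + 6 * (mun n * (1 - 3 * rho n)^-1) *
     (4 * D ^+ 2 + vhi + Num.sqrt (l n) + 4 * D * Num.sqrt shi * (n%:R `^ 4^-1)^-1
      + l n * (Num.sqrt n%:R)^-1)).
  apply: subpoly_le; near=> n; rewrite le_eqVlt; apply/orP; left; apply/eqP.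
  congr Num.norm; rewrite /B1 /nun /mun !invfM; ring.
by repeat first [exact: sc | exact: sl | exact: snu | exact: smu | exact: sr3
  | exact: ssl | exact: snn | exact: sq4 | exact: sir | apply: subpolyD | apply: subpolyM].
Unshelve. all: end_near. Qed.

Theorem theorem3p6 (R : realType)
  (S dS : R -> R)
  (QQ : forall n : nat, set (probability (D_space (n%:R : R)) R))
  (sigma varsigma : forall n : nat, probability (D_space (n%:R : R)) R -> R)
  (I : forall n : nat, probability (D_space (n%:R : R)) R ->
       (R -> R) -> D_space (n%:R : R) -> R)
  (l : nat -> R) (vlo vhi shi : R)
  (k : nat -> nat) (eps rho : nat -> R)
  (HQ : forall n Q, (0 < n)%N -> QQ n Q ->
     noise_law Q (sigma n Q) (I n Q) /\ 0 < varsigma n Q)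
  (Hl_pos : forall n, (0 < n)%N -> 0 < l n)
  (Hl_incr : forall m n, (0 < m)%N -> (m <= n)%N -> l m <= l n)
  (Hl_infty : l n @[n --> \oo] --> +oo)
  (Hl_slow : forall delta : R, 0 < delta ->
     l n / n%:R `^ delta @[n --> \oo] --> (0 : R))
  (HL : forall n Q, (0 < n)%N -> QQ n Q ->
     (L1n Q (I n Q) (varsigma n Q) + L2n Q (I n Q) <= (l n)%:E)%E)
  (Hvlo_pos : 0 < vlo)
  (Hvlo : forall n, (0 < n)%N ->
     ereal_inf [set (varsigma n Q)%:E | Q in QQ n] = vlo%:E)
  (Hvhi : forall n, (0 < n)%N ->
     ereal_sup [set (varsigma n Q)%:E | Q in QQ n] = vhi%:E)
  (Hshi : forall n, (0 < n)%N ->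
     ereal_sup [set (sigma n Q)%:E | Q in QQ n] = shi%:E)
  (HS_per : forall t, S (t + 1) = S t)
  (HS_L2 : L2 1 S)
  (HS_C1 : C1_signal S dS)
  (HS_L1 : (L1norm dS < +oo)%E)
  (Hk_pos : forall n, (0 < n)%N -> (1 <= k n)%N)
  (Hk_infty : (k n)%:R @[n --> \oo] --> (+oo : set_system R))
  (Hk_slow : (k n)%:R / ln n%:R @[n --> \oo] --> (0 : R))
  (Heps : forall n, (0 < n)%N -> 0 < eps n <= 1)
  (Heps_0 : eps n @[n --> \oo] --> (0 : R))
  (Heps_slow : forall delta : R, 0 < delta ->
     n%:R `^ delta * eps n @[n --> \oo] --> +oo)
  (Hrho : forall n, (0 < n)%N -> 0 < rho n < 3^-1)
  (Hrho_0 : rho n @[n --> \oo] --> (0 : R))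
  (Hrho_slow : forall delta : R, 0 < delta ->
     n%:R `^ delta * rho n @[n --> \oo] --> +oo) :
  let Gam := fun n => weights n (k n) (eps n) in
  let B := fun n => B1 vlo vhi shi (fine (L1norm dS)) n (l n)
                      (nu (Gam n)) (mu (Gam n)) (rho n) in
  (forall n : nat, (2 <= n)%N ->
     (forall g, Gam n g ->
        (forall j, 0 <= g j <= 1) /\ (0 < nb_supp g <= n)%N) ->
     forall ghat : ((R -> R) -> R) -> nat -> R,
     cost_minimizer n (Gam n) (rho n) ghat ->
     (robust_risk S (QQ n) (I n) (S_select n ghat)
      <= ((1 + 3 * rho n - 2 * rho n ^+ 2) / (1 - 3 * rho n))%:E
         * \big[Order.min/+oo]_(g <- fset_set (Gam n))
             robust_risk S (QQ n) (I n) (S_hat n g)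
         + (B n / n%:R)%:E)%E) /\
  (forall delta : R, 0 < delta ->
     B n / n%:R `^ delta @[n --> \oo] --> (0 : R)).
Proof.
move=> Gam B; split; last first.
  exact: (B1_subpoly _ l vlo vhi shi _ k eps rho).
move=> n n2 HG ghat Hmin; have n0 : (0 < n)%N by exact: leq_trans n2.
have rho3 := Hrho n n0; have /andP[r0 r3] := rho3.
have r3' : 0 < 1 - 3 * rho n by lra.
set c := _ / (1 - 3 * rho n).
have c0 : 0 < c.
  rewrite divr_gt0//; have : rho n * rho n < rho n * 3^-1 by rewrite ltr_pM2l.
  by rewrite expr2; lra.
have finG := finite_weights n (k n) (eps n).
have le_each g0 : Gam n g0 -> (robust_risk S (QQ n) (I n) (S_select n ghat) <=
    c%:E * robust_risk S (QQ n) (I n) (S_hat n g0) + (B n / n%:R)%:E)%E.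
  move=> Gg0; apply: ge_ereal_sup => _ [Q QQn <-].
  have [HN vs0] := HQ n Q n0 QQn.
  have [rk [rkE [rk0 H]]] := fixed_law_oracle Q (I n Q) (sigma n Q) (varsigma n Q)
    (l n) (rho n) S dS (Gam n) n0 HN vs0 (HL n Q n0 QQn) HS_per HS_L2 HS_C1 HS_L1
    rho3 finG HG ghat g0 Hmin Gg0.
  apply: le_trans H _; rewrite EFinD; apply: leeD.
    rewrite EFinM lee_wpmul2l ?lee_fin ?(ltW c0)// -rkE.
    by apply: ereal_sup_ubound; exists Q.
  rewrite lee_fin mulrC ler_pM2r ?invr_gt0 ?ltr0n//.
  apply: fixed_law_le_B1 => //.
  - by rewrite -lee_fin -(Hvlo n n0); apply: ereal_inf_lbound; exists Q.
  - by rewrite -lee_fin -(Hvhi n n0); apply: ereal_sup_ubound; exists Q.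
  - by case: HN.
  - by rewrite -lee_fin -(Hshi n n0); apply: ereal_sup_ubound; exists Q.
  - exact/ltW/Hl_pos.
  - exact: L1norm_ge0.
rewrite big_seq; apply: (big_ind (fun m => (robust_risk S (QQ n) (I n) (S_select n ghat)
    <= c%:E * m + (B n / n%:R)%:E)%E)).
- by rewrite gt0_muley ?lte_fin// addye// leey.
- by move=> x y hx hy; rewrite /Order.min; case: ifP.
- by move=> g; rewrite in_fset_set// inE; exact: le_each.
Qed.
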